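(* Let $0<r<R$ and let $p(x)=\sum_{n=2}^\infty \frac{a_n}{x^n}$ be a real analytic function, the series being absolutely convergent for $|x|>r$, such that $p(x)\ge 0$ for all real $x$ with $|x|\ge R$. Let $\lambda(dx)=p(x)\mathbf{1}_{\{|x|\ge R\}}(x)\,dx$. Let $b_n$ and $c_n$ ($n\ge0$) be the complex numbers determined by $$\widetilde{G}_\lambda(z)=\sum_{n=0}^\infty \frac{b_n}{z^{n+1}}\ \ (|z|>R),\qquad \widetilde{\mathcal{F}}_\lambda(z)=\sum_{n=0}^\infty\frac{c_n}{n!}(iz)^n\ \ (z\in\mathbb{C}),$$ where $\widetilde{G}_\lambda$ is the analytic continuation of the Stieltjes transform $G_\lambda|_{\mathbb{C}_-}$ to $\mathbb{C}_-\cup\{|z|>R\}$ and $\widetilde{\mathcal{F}}_\lambda$ is the entire function extending $\mathcal{F}_\lambda|_{(0,\infty)}$. Then $b_n=c_n$ for all $n\ge 0$, and $$b_n=c_n=\int_{\gamma_R}z^n p(z)\,dz,$$ where $\gamma_R=\{Re^{i\theta} : 0\le\theta\le\pi\}$ is equipped with the counterclockwise direction.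
   Context: $\mathbb{C}_-=\{z\in\mathbb{C} : \operatorname{Im} z<0\}$. For a finite positive measure $\lambda$ on $\mathbb{R}$: $G_\lambda(z)=\int_{\mathbb{R}}\frac{\lambda(dx)}{z-x}$ for $z\in\mathbb{C}\setminus\mathbb{R}$ and $\mathcal{F}_\lambda(z)=\int_{\mathbb{R}}e^{ixz}\lambda(dx)$ for $z\in\mathbb{R}$. For complex $z$ with $|z|>r$, $p(z)=\sum_{n=2}^\infty a_n z^{-n}$. For $\lambda$ as in the claim, it is known that the continuations $\widetilde{G}_\lambda$ and $\widetilde{\mathcal{F}}_\lambda$ exist and have expansions of the displayed forms. *)

(* Defs.v *)
From HB Require Import structures.
From mathcomp Require Import all_boot all_order all_algebra.
From mathcomp Require Import all_classical all_reals all_analysis.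
From mathcomp Require Import complex.
Import Order.TTheory GRing.Theory Num.Theory.
Import numFieldNormedType.Exports.

Set Implicit Arguments.
Unset Strict Implicit.
Unset Printing Implicit Defensive.

Local Open Scope classical_set_scope.
Local Open Scope ring_scope.

(* R[i] itself carries no topology in the library.  Seen as a numClosedFieldType
   it gets the topology of its norm and is a normed module over itself, so that
   derivable _ _ 1 is complex differentiability.  The norm `|z| lives in Cx R,
   hence comparisons such as toC r < `|z|. *)
Definition Cx (R : realType) : numClosedFieldType := R[i].

Definition toC (R : realType) (x : R) : Cx R := Complex x 0.

Definition iC (R : realType) : Cx R := Complex 0 1.
Arguments iC {R}.

Definition cexp (R : realType) (z : Cx R) : Cx R :=
  Complex (expR (complex.Re z) * cos (complex.Im z))
          (expR (complex.Re z) * sin (complex.Im z)).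

Definition Cintegral d (T : measurableType d) (R : realType)
    (mu : {measure set T -> \bar R}) (D : set T) (f : T -> Cx R) : Cx R :=
  Complex (\int[mu]_(x in D) complex.Re (f x))
          (\int[mu]_(x in D) complex.Im (f x)).

Definition stieltjes (R : realType)
    (lam : {measure set (measurableTypeR R) -> \bar R}) (z : Cx R) : Cx R :=
  Cintegral lam setT (fun x : R => (z - toC x)^-1).

Definition fourier (R : realType)
    (lam : {measure set (measurableTypeR R) -> \bar R}) (z : R) : Cx R :=
  Cintegral lam setT (fun x : R => cexp (iC * toC x * toC z)).

(* Used with K = R and with K = Cx R.  It is the sum of the series wherever the
   series converges, and a junk value elsewhere. *)
Definition inv_series (K : numFieldType) (a : nat -> K) (z : K) : K :=
  limn (fun N => \sum_(2 <= n < N) a n / z ^+ n).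

(* Meant for open D, where complex differentiability is analyticity. *)
Definition holomorphic_on (R : realType) (D : set (Cx R))
    (f : Cx R -> Cx R) : Prop :=
  forall z, D z -> derivable f z 1.

Definition lower_half_plane (R : realType) : set (Cx R) :=
  [set z | complex.Im z < 0].
Arguments lower_half_plane {R}.

Definition disk_exterior (R : realType) (rho : R) : set (Cx R) :=
  [set z | toC rho < `|z|].

Definition arc (R : realType) (rho theta : R) : Cx R :=
  toC rho * cexp (iC * toC theta).

(* Contour integral over theta |-> arc rho theta, theta from 0 to pi, whose
   derivative in theta is iC * arc rho theta. *)
Definition arc_integral (R : realType) (rho : R) (f : Cx R -> Cx R) : Cx R :=
  Cintegral (@lebesgue_measure R) `[0, pi]
    (fun theta : R => f (arc rho theta) * (iC * arc rho theta)).

(* Main.v *)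
(** On the closed upper half-plane outside the disk of radius rho, p(w) decays
    like |w|^-2, so for h bounded and holomorphic there, Cauchy's theorem moves
    the integral of p h over {|x| >= rho} onto the half circle of radius rho.
    This gives F(u) = \int e^(iuw) p(w) dw over the arc for u > 0, and, for
    z = 1/(iu) with u small, z G(z) = \int (1 - iuw)^-1 p(w) dw over the arc.
    Both kernels are power series in q = iuw, with coefficients 1/n! and 1, so
    comparing asymptotic expansions as u -> 0+ identifies c_n/n! and b_n with
    1/n! and 1 times \int w^n p(w) dw.  Cauchy's theorem itself is only needed
    on half annuli, that is on rectangles in polar coordinates, where it is
    differentiation under the integral sign. *)

Require Import Defs.
From mathcomp Require Import all_boot all_order all_algebra.
From mathcomp Require Import all_classical all_reals all_analysis.
From mathcomp Require Import measurable_realfun complex ring lra.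
Import Order.TTheory GRing.Theory Num.Theory.
Import numFieldNormedType.Exports.

Set Implicit Arguments.
Unset Strict Implicit.
Unset Printing Implicit Defensive.

Local Open Scope classical_set_scope.
Local Open Scope ring_scope.

(** * Complex numbers by components *)

(** The obstacle is that [p] need not have moments: it decays only like |x|^-2, so expanding a
    kernel under the integral over the line produces, in general, divergent integrals. On the half
    circle every power is integrable, which is why the contour is moved before anything is expanded.
    The sum of the series is available only as a limit. Cauchy's theorem is therefore applied to the
    partial sums, which are visibly holomorphic off 0, and carried over to [p] by bounded
    convergence on bounded segments and arcs, with a bound B / |w|^2 that does not depend on the
    partial sum. The same bound makes the outer arc vanish, although its length grows like its
    radius. The point z = 1 / (iu) = - i / u lies in the lower half-plane, where [Gt] is the
    integral, and for u < 1 / rho also outside the disk, where [Gt] is the series. Expansions are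
    compared to finite order only, so no infinite sum over n has to be exchanged with the arc
    integral of a kernel. *)

Section ComplexPlane.
Variable R : realType.
Implicit Types z w : Cx R.

Lemma CxP z w : complex.Re z = complex.Re w -> complex.Im z = complex.Im w ->
  z = w.
Proof. by case: z w => [a b] [c d] /= -> ->. Qed.

Lemma ReD z w : complex.Re (z + w) = complex.Re z + complex.Re w.
Proof. by case: z w => [a b] [c d]. Qed.

Lemma ImD z w : complex.Im (z + w) = complex.Im z + complex.Im w.
Proof. by case: z w => [a b] [c d]. Qed.

Lemma ReN z : complex.Re (- z) = - complex.Re z.
Proof. by case: z. Qed.

Lemma ImN z : complex.Im (- z) = - complex.Im z.
Proof. by case: z. Qed.

Lemma ReM z w : complex.Re (z * w) =
  complex.Re z * complex.Re w - complex.Im z * complex.Im w.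
Proof. by case: z w => [a b] [c d]. Qed.

Lemma ImM z w : complex.Im (z * w) =
  complex.Re z * complex.Im w + complex.Im z * complex.Re w.
Proof. by case: z w => [a b] [c d]. Qed.

Lemma ReV z : complex.Re z^-1 =
  complex.Re z / (complex.Re z ^+ 2 + complex.Im z ^+ 2).
Proof. by case: z. Qed.

Lemma ImV z : complex.Im z^-1 =
  - complex.Im z / (complex.Re z ^+ 2 + complex.Im z ^+ 2).
Proof. by case: z => [a b]; rewrite /= mulNr. Qed.

Lemma Re0 : complex.Re (0 : Cx R) = 0. Proof. by []. Qed.
Lemma Im0 : complex.Im (0 : Cx R) = 0. Proof. by []. Qed.
Lemma Re1 : complex.Re (1 : Cx R) = 1. Proof. by []. Qed.
Lemma Im1 : complex.Im (1 : Cx R) = 0. Proof. by []. Qed.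

Definition ReImE := (Re0, Im0, Re1, Im1, ReD, ImD, ReN, ImN, ReM, ImM).

Lemma toCD (x y : R) : toC (x + y) = toC x + toC y.
Proof. by apply: CxP; rewrite !ReImE /= ?addr0. Qed.

Lemma toCN (x : R) : toC (- x) = - toC x.
Proof. by apply: CxP; rewrite !ReImE /= ?oppr0. Qed.

Lemma toCM (x y : R) : toC (x * y) = toC x * toC y.
Proof. by apply: CxP; rewrite !ReImE /=; ring. Qed.

Lemma toC0 : toC (0 : R) = 0. Proof. by []. Qed.

Lemma toC1 : toC (1 : R) = 1. Proof. by []. Qed.

Lemma toCV (x : R) : toC x^-1 = (toC x)^-1.
Proof.
apply: CxP; rewrite ?ReV ?ImV /= expr0n /= addr0; last by rewrite oppr0 mul0r.
have [->|x0] := eqVneq x 0; first by rewrite invr0 mul0r.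
by field.
Qed.

Lemma toCX (x : R) n : toC (x ^+ n) = toC x ^+ n.
Proof. by elim: n => [|n IH]; rewrite ?expr0 // !exprS toCM IH. Qed.

Lemma toC_sum (I : Type) (s : seq I) (P : pred I) (F : I -> R) :
  toC (\sum_(i <- s | P i) F i) = \sum_(i <- s | P i) toC (F i).
Proof. exact: (big_morph _ toCD toC0). Qed.

Lemma Re_sum (I : Type) (s : seq I) (P : pred I) (F : I -> Cx R) :
  complex.Re (\sum_(i <- s | P i) F i) = \sum_(i <- s | P i) complex.Re (F i).
Proof. exact: (big_morph _ ReD Re0). Qed.

Lemma Im_sum (I : Type) (s : seq I) (P : pred I) (F : I -> Cx R) :
  complex.Im (\sum_(i <- s | P i) F i) = \sum_(i <- s | P i) complex.Im (F i).
Proof. exact: (big_morph _ ImD Im0). Qed.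

(** The norm of [Cx R] takes values in [Cx R], where the order is partial. This real-valued copy
    lets all estimates take place in [R]. *)
Definition cabs z : R := complex.Re `|z|.

Lemma cabsE z : cabs z = Num.sqrt (complex.Re z ^+ 2 + complex.Im z ^+ 2).
Proof. by rewrite /cabs normc_def. Qed.

Lemma normCx z : `|z| = toC (cabs z).
Proof. by rewrite cabsE [LHS]normc_def. Qed.

Lemma cabs_ge0 z : 0 <= cabs z.
Proof. by rewrite cabsE sqrtr_ge0. Qed.

Lemma cabs0 : cabs 0 = 0.
Proof. by rewrite /cabs normr0. Qed.

Lemma cabsM z w : cabs (z * w) = cabs z * cabs w.
Proof. by rewrite {1}/cabs normrM !normCx -toCM. Qed.

Lemma cabs1 : cabs 1 = 1.
Proof. by rewrite /cabs normr1. Qed.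

Lemma cabsX z n : cabs (z ^+ n) = cabs z ^+ n.
Proof. by elim: n => [|n IH]; rewrite ?cabs1 // !exprS cabsM IH. Qed.

Lemma cabsV z : cabs z^-1 = (cabs z)^-1.
Proof. by rewrite {1}/cabs normfV normCx -toCV. Qed.

Lemma cabsN z : cabs (- z) = cabs z.
Proof. by rewrite /cabs normrN. Qed.

Lemma cabsD z w : cabs (z + w) <= cabs z + cabs w.
Proof. by have := ler_normD z w; rewrite !normCx -toCD lecE => /andP[]. Qed.

Lemma cabs_toC (x : R) : cabs (toC x) = `|x|.
Proof. by rewrite cabsE /= expr0n addr0 sqrtr_sqr. Qed.

Lemma cabs_iC : cabs (iC : Cx R) = 1.
Proof. by rewrite cabsE /= expr0n expr1n add0r sqrtr1. Qed.

Lemma cabs_eq0 z : cabs z = 0 -> z = 0.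
Proof. by move=> z0; apply: normr0_eq0; rewrite normCx z0. Qed.

Lemma cabs_gt0 z : (0 < cabs z) = (z != 0).
Proof.
rewrite lt_neqAle cabs_ge0 andbT eq_sym; congr (~~ _).
by apply/eqP/eqP => [/cabs_eq0|->]; rewrite ?cabs0.
Qed.

Lemma normRe_le z : `|complex.Re z| <= cabs z.
Proof. by rewrite cabsE -sqrtr_sqr ler_wsqrtr // lerDl sqr_ge0. Qed.

Lemma normIm_le z : `|complex.Im z| <= cabs z.
Proof. by rewrite cabsE -sqrtr_sqr ler_wsqrtr // lerDr sqr_ge0. Qed.

Lemma cabs_le z : cabs z <= `|complex.Re z| + `|complex.Im z|.
Proof.
rewrite cabsE -(ler_sqr (x := Num.sqrt _)) ?nnegrE ?sqrtr_ge0 ?addr_ge0 //.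
rewrite sqr_sqrtr ?addr_ge0 ?sqr_ge0 // sqrrD !real_normK ?num_real //.
by rewrite lerD2r lerDl mulrn_wge0 // mulr_ge0.
Qed.

Lemma cabs_sum (I : Type) (s : seq I) (P : pred I) (F : I -> Cx R) :
  cabs (\sum_(i <- s | P i) F i) <= \sum_(i <- s | P i) cabs (F i).
Proof.
elim/big_rec2: _ => [|i y x _ IH]; first by rewrite cabs0.
by rewrite (le_trans (cabsD _ _)) // lerD2l.
Qed.

Lemma cvg_cabsP (T : Type) (F : set_system T) {FF : Filter F} (f : T -> Cx R)
    (l : Cx R) :
  f @ F --> l <-> forall e : R, 0 < e -> \forall t \near F, cabs (l - f t) < e.
Proof.
split=> [/cvgrPdist_lt h e e0|h].
  have /h : 0 < toC e by rewrite ltcE /= eqxx.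
  by apply: filterS => t; rewrite normCx ltcE /= => /andP[].
(* A positive element of [Cx R] has zero imaginary part, so testing real radii suffices. *)
apply/cvgrPdist_lt => -[e e']; rewrite ltcE /= => /andP[/eqP -> /h].
by apply: filterS => t; rewrite normCx ltcE /= eqxx.
Qed.

Lemma cvg_Re_Im (T : Type) (F : set_system T) {FF : Filter F} (f : T -> Cx R)
    (l : Cx R) :
  (fun t => complex.Re (f t)) @ F --> complex.Re l ->
  (fun t => complex.Im (f t)) @ F --> complex.Im l ->
  f @ F --> l.
Proof.
move=> hr hi; apply/cvg_cabsP => e e0.
have e20 : 0 < e / 2 by rewrite divr_gt0.
move/cvgrPdist_lt : hr => /(_ _ e20) hr; move/cvgrPdist_lt : hi => /(_ _ e20) hi.
near=> t; apply: (le_lt_trans (cabs_le _)).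
rewrite !ReImE [ltRHS]splitr ltrD //; near: t; [exact: hr|exact: hi].
Unshelve. all: by end_near. Qed.

Lemma cvg_Re (T : Type) (F : set_system T) {FF : Filter F} (f : T -> Cx R)
    (l : Cx R) :
  f @ F --> l -> (fun t => complex.Re (f t)) @ F --> complex.Re l.
Proof.
move/cvg_cabsP => h; apply/cvgrPdist_lt => e /h; apply: filterS => t.
by apply: le_lt_trans; rewrite -ReN -ReD normRe_le.
Qed.

Lemma cvg_Im (T : Type) (F : set_system T) {FF : Filter F} (f : T -> Cx R)
    (l : Cx R) :
  f @ F --> l -> (fun t => complex.Im (f t)) @ F --> complex.Im l.
Proof.
move/cvg_cabsP => h; apply/cvgrPdist_lt => e /h; apply: filterS => t.
by apply: le_lt_trans; rewrite -ImN -ImD normIm_le.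
Qed.

Lemma cvg_cabs (T : Type) (F : set_system T) {FF : Filter F} (f : T -> Cx R)
    (l : Cx R) :
  f @ F --> l -> (fun t => cabs (f t)) @ F --> cabs l.
Proof. by move=> /cvg_norm; rewrite normCx => /cvg_Re. Qed.

Lemma cvg_toC (T : Type) (F : set_system T) {FF : Filter F} (f : T -> R)
    (l : R) :
  f @ F --> l -> (fun t => toC (f t)) @ F --> toC l.
Proof. by move=> h; apply: cvg_Re_Im => //=; exact: cvg_cst. Qed.

End ComplexPlane.

(** * Complex differentiation along curves *)

Section CurveCalculus.
Variable R : realType.
Implicit Types (phi psi : R -> Cx R) (D : set (Cx R)).

Definition cderiv phi (x : R) (l : Cx R) : Prop :=
  is_derive x 1 (fun t => complex.Re (phi t)) (complex.Re l) /\
  is_derive x 1 (fun t => complex.Im (phi t)) (complex.Im l).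

Lemma cderiv_cst (k : Cx R) x : cderiv (fun=> k) x 0.
Proof. by split; exact: is_derive_cst. Qed.

Lemma cderivD phi psi x l m : cderiv phi x l -> cderiv psi x m ->
  cderiv (fun t => phi t + psi t) x (l + m).
Proof.
move=> [p1 p2] [q1 q2]; split; rewrite !ReImE.
- by under eq_fun do rewrite ReD; exact: is_deriveD.
- by under eq_fun do rewrite ImD; exact: is_deriveD.
Qed.

Lemma cderivM phi psi x l m : cderiv phi x l -> cderiv psi x m ->
  cderiv (fun t => phi t * psi t) x (l * psi x + phi x * m).
Proof.
move=> [p1 p2] [q1 q2]; split; rewrite !ReImE.
- under eq_fun do rewrite ReM.
  apply: is_derive_eq; rewrite /GRing.scale /=; ring.
- under eq_fun do rewrite ImM.
  apply: is_derive_eq; rewrite /GRing.scale /=; ring.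
Qed.

Lemma sqrReIm_neq0 (z : Cx R) : z != 0 ->
  complex.Re z ^+ 2 + complex.Im z ^+ 2 != 0.
Proof.
apply: contra => /eqP z0; apply/eqP/cabs_eq0.
by rewrite cabsE z0 sqrtr0.
Qed.

Lemma cderivV phi x l : phi x != 0 -> cderiv phi x l ->
  cderiv (fun t => (phi t)^-1) x (- (phi x)^-1 ^+ 2 * l).
Proof.
move=> /sqrReIm_neq0 n0 [p1 p2].
have dn : is_derive x 1
   (fun t => complex.Re (phi t) ^+ 2 + complex.Im (phi t) ^+ 2)
   (complex.Re (phi x) * complex.Re l *+ 2 +
    complex.Im (phi x) * complex.Im l *+ 2).
  by apply: is_derive_eq; rewrite /GRing.scale /=; ring.
have dV := @is_deriveV R
  (fun t => complex.Re (phi t) ^+ 2 + complex.Im (phi t) ^+ 2) x _ 1 n0 dn.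
split; rewrite expr2 !ReImE !ReV !ImV.
- under eq_fun do rewrite ReV.
  apply: is_derive_eq; rewrite /GRing.scale /=; field; exact: n0.
- under eq_fun do rewrite ImV.
  apply: is_derive_eq; rewrite /GRing.scale /=; field; exact: n0.
Qed.

Lemma cderiv_cexp phi x l : cderiv phi x l ->
  cderiv (fun t => cexp (phi t)) x (cexp (phi x) * l).
Proof.
move=> [p1 p2]; split; rewrite /cexp !ReImE /=.
- have e := is_derive1_comp (is_derive_expR (complex.Re (phi x))) p1.
  have s := is_derive1_comp (is_derive_cos (complex.Im (phi x))) p2.
  apply: is_derive_eq; rewrite /GRing.scale /=; ring.
- have e := is_derive1_comp (is_derive_expR (complex.Re (phi x))) p1.
  have s := is_derive1_comp (is_derive_sin (complex.Im (phi x))) p2.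
  apply: is_derive_eq; rewrite /GRing.scale /=; ring.
Qed.

Lemma cderiv_cvg phi x l : cderiv phi x l -> phi @ x --> phi x.
Proof.
move=> [p1 p2]; apply: cvg_Re_Im.
- by apply/differentiable_continuous/derivable1_diffP.
- by apply/differentiable_continuous/derivable1_diffP.
Qed.

Lemma cexp_continuous : continuous (@cexp R).
Proof.
move=> z.
have re : (fun w : Cx R => complex.Re w) @ z --> complex.Re z.
  exact: (@cvg_Re R _ (nbhs z) _ id z).
have im : (fun w : Cx R => complex.Im w) @ z --> complex.Im z.
  exact: (@cvg_Im R _ (nbhs z) _ id z).
have ex := cvg_comp _ _ re (@continuous_expR R _).
have co := cvg_comp _ _ im (@continuous_cos R _).
have si := cvg_comp _ _ im (@continuous_sin R _).
apply: (@cvg_Re_Im R _ (nbhs z)) => /=.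
- exact: cvgM ex co.
- exact: cvgM ex si.
Qed.

(* Complex differentiability at w is tested along differentiable curves through
   w, because Cx R is not a normed module over R. *)
Definition c1_with D (f f' : Cx R -> Cx R) : Prop :=
  [/\ forall phi x l, D (phi x) -> cderiv phi x l ->
        cderiv (fun t => f (phi t)) x (f' (phi x) * l),
      forall w, D w -> f @ w --> f w &
      forall w, D w -> f' @ w --> f' w].

Definition c1_on D f := exists f', c1_with D f f'.

Lemma c1_cst D (k : Cx R) : c1_on D (fun=> k).
Proof.
exists (fun=> 0); split => [phi x l _ _|w _|w _].
- by rewrite mul0r; exact: cderiv_cst.
- exact: (@cvg_cst _ k _ (nbhs w)).
- exact: (@cvg_cst _ (0 : Cx R) _ (nbhs w)).
Qed.

Lemma c1_id D : c1_on D id.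
Proof.
exists (fun=> 1); split => [phi x l _ p|w _|w _].
- by rewrite mul1r.
- exact: (@cvg_id _ (nbhs w)).
- exact: (@cvg_cst _ (1 : Cx R) _ (nbhs w)).
Qed.

Lemma c1D D f g : c1_on D f -> c1_on D g -> c1_on D (fun w => f w + g w).
Proof.
move=> [f' [fd fc fc']] [g' [gd gc gc']].
exists (fun w => f' w + g' w); split => [phi x l Dx p|w Dw|w Dw].
- by rewrite mulrDl; apply: cderivD; [exact: fd|exact: gd].
- exact: cvgD (fc w Dw) (gc w Dw).
- exact: cvgD (fc' w Dw) (gc' w Dw).
Qed.

Lemma c1M D f g : c1_on D f -> c1_on D g -> c1_on D (fun w => f w * g w).
Proof.
move=> [f' [fd fc fc']] [g' [gd gc gc']].
exists (fun w => f' w * g w + f w * g' w); split => [phi x l Dx p|w Dw|w Dw].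
- have -> : (f' (phi x) * g (phi x) + f (phi x) * g' (phi x)) * l =
    f' (phi x) * l * g (phi x) + f (phi x) * (g' (phi x) * l) by ring.
  by apply: cderivM; [exact: fd|exact: gd].
- exact: cvgM (fc w Dw) (gc w Dw).
- exact: cvgD (cvgM (fc' w Dw) (gc w Dw)) (cvgM (fc w Dw) (gc' w Dw)).
Qed.

Lemma c1V D f : (forall w, D w -> f w != 0) -> c1_on D f ->
  c1_on D (fun w => (f w)^-1).
Proof.
move=> f0 [f' [fd fc fc']].
exists (fun w => - ((f w)^-1 * (f w)^-1) * f' w).
split => [phi x l Dx p|w Dw|w Dw].
- rewrite -expr2 -mulrA; apply: (cderivV (phi := fun t => f (phi t))).
    exact: f0.
  exact: fd.
- exact: cvgV (f0 w Dw) (fc w Dw).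
- have fV : (fun v => (f v)^-1) @ w --> (f w)^-1.
    exact: cvgV (f0 w Dw) (fc w Dw).
  have fN : (fun v => - ((f v)^-1 * (f v)^-1)) @ w --> - ((f w)^-1 * (f w)^-1).
    exact: cvgN (cvgM fV fV).
  exact: cvgM fN (fc' w Dw).
Qed.

Lemma c1_cexp D f : c1_on D f -> c1_on D (fun w => cexp (f w)).
Proof.
move=> [f' [fd fc fc']].
have cc w : D w -> (fun w => cexp (f w)) @ w --> cexp (f w).
  by move=> Dw; exact: (cvg_comp _ _ (fc w Dw) (@cexp_continuous _)).
exists (fun w => cexp (f w) * f' w); split => [phi x l Dx p|w Dw|w Dw].
- rewrite -mulrA; apply: (cderiv_cexp (phi := fun t => f (phi t))).
  exact: fd.
- exact: cc.
- exact: cvgM (cc w Dw) (fc' w Dw).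
Qed.

Lemma c1X D f n : c1_on D f -> c1_on D (fun w => f w ^+ n).
Proof.
move=> cf; elim: n => [|n IH]; first exact: c1_cst.
by under eq_fun do rewrite exprS; exact: c1M.
Qed.

Lemma c1_sum D (I : Type) (s : seq I) (F : I -> Cx R -> Cx R) :
  (forall i, c1_on D (F i)) -> c1_on D (fun w => \sum_(i <- s) F i w).
Proof.
move=> cF; elim: s => [|i s IH].
  by under eq_fun do rewrite big_nil; exact: c1_cst.
rewrite (_ : (fun w => _) = (fun w => F i w + \sum_(j <- s) F j w)); last first.
  by apply/funext => w; rewrite big_cons.
exact: c1D (cF i) IH.
Qed.

End CurveCalculus.

(** * Complex-valued integrals *)

Section ComplexIntegral.
Context d (T : measurableType d) (R : realType).
Implicit Types (D : set T) (f g : T -> Cx R).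

Definition cmeasurable D f : Prop :=
  measurable_fun D (fun x => complex.Re (f x)) /\
  measurable_fun D (fun x => complex.Im (f x)).

Lemma cmeasurableM D f g : cmeasurable D f -> cmeasurable D g ->
  cmeasurable D (fun x => f x * g x).
Proof.
move=> [f1 f2] [g1 g2]; split.
- under eq_fun do rewrite ReM.
  by apply: measurable_funB; exact: measurable_funM.
- under eq_fun do rewrite ImM.
  by apply: measurable_funD; exact: measurable_funM.
Qed.

Lemma cmeasurable_cvg D (F : nat -> T -> Cx R) f :
  measurable D -> (forall n, cmeasurable D (F n)) ->
  (forall x, D x -> F ^~ x @ \oo --> f x) -> cmeasurable D f.
Proof.
move=> mD mF Ff; split.
- apply: (measurable_fun_cvg (h := fun n x => complex.Re (F n x))).
  + by move=> n; case: (mF n).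
  + by move=> x Dx; exact: cvg_Re (Ff x Dx).
- apply: (measurable_fun_cvg (h := fun n x => complex.Im (F n x))).
  + by move=> n; case: (mF n).
  + by move=> x Dx; exact: cvg_Im (Ff x Dx).
Qed.

Variable mu : {measure set T -> \bar R}.

Definition cintegrable D f : Prop :=
  mu.-integrable D (EFin \o (fun x => complex.Re (f x))) /\
  mu.-integrable D (EFin \o (fun x => complex.Im (f x))).

Lemma Rintegrable_bounded D (h : T -> R) K : measurable D -> (mu D < +oo)%E ->
  measurable_fun D h -> (forall x, D x -> `|h x| <= K) ->
  mu.-integrable D (EFin \o h).
Proof.
move=> mD muD mh hK; apply: measurable_bounded_integrable => //.
exists K; split; first exact: num_real.
by move=> M KM x Dx; exact: le_trans (hK x Dx) (ltW KM).
Qed.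

Lemma cintegrable_bounded D f K : measurable D -> (mu D < +oo)%E ->
  cmeasurable D f -> (forall x, D x -> cabs (f x) <= K) -> cintegrable D f.
Proof.
move=> mD muD [f1 f2] fK; split; apply: (Rintegrable_bounded (K := K)) => //.
- by move=> x Dx; exact: le_trans (normRe_le _) (fK x Dx).
- by move=> x Dx; exact: le_trans (normIm_le _) (fK x Dx).
Qed.

Lemma eq_Cintegral D f g : (forall x, D x -> f x = g x) ->
  Cintegral mu D f = Cintegral mu D g.
Proof.
move=> fg; congr Complex; apply: eq_Rintegral => x /set_mem Dx;
  by rewrite fg.
Qed.

Lemma Cintegral0 D : Cintegral mu D (fun=> 0) = 0.
Proof. by apply: CxP => /=; rewrite /Rintegral integral0. Qed.

Lemma CintegralD D f g : measurable D -> cintegrable D f -> cintegrable D g ->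
  Cintegral mu D (fun x => f x + g x) = Cintegral mu D f + Cintegral mu D g.
Proof.
move=> mD [f1 f2] [g1 g2]; apply: CxP; rewrite ?ReD ?ImD /=.
- by rewrite -RintegralD //; under eq_Rintegral do rewrite ReD.
- by rewrite -RintegralD //; under eq_Rintegral do rewrite ImD.
Qed.

Lemma cintegrableD D f g : measurable D -> cintegrable D f -> cintegrable D g ->
  cintegrable D (fun x => f x + g x).
Proof.
move=> mD [f1 f2] [g1 g2]; split.
- under eq_fun do rewrite ReD.
  exact: (integrableD mD f1 g1).
- under eq_fun do rewrite ImD.
  exact: (integrableD mD f2 g2).
Qed.

Let RintegrableZl D (a : R) (h : T -> R) : measurable D ->
  mu.-integrable D (EFin \o h) ->
  mu.-integrable D (EFin \o (fun x => a * h x)).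
Proof.
move=> mD ih; rewrite /comp; under eq_fun do rewrite EFinM.
exact: (integrableZl mD a ih).
Qed.

Lemma cintegrableZl D (k : Cx R) f : measurable D -> cintegrable D f ->
  cintegrable D (fun x => k * f x).
Proof.
move=> mD [f1 f2].
have Z a h := @RintegrableZl D a h mD.
split.
- under eq_fun do rewrite ReM.
  rewrite /comp; under eq_fun do rewrite EFinB.
  exact: (integrableB mD (Z _ _ f1) (Z _ _ f2)).
- under eq_fun do rewrite ImM.
  rewrite /comp; under eq_fun do rewrite EFinD.
  exact: (integrableD mD (Z _ _ f2) (Z _ _ f1)).
Qed.

Lemma CintegralZl D (k : Cx R) f : measurable D -> cintegrable D f ->
  Cintegral mu D (fun x => k * f x) = k * Cintegral mu D f.
Proof.
move=> mD [f1 f2].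
have Z a h := @RintegrableZl D a h mD.
apply: CxP; rewrite ?ReM ?ImM /=.
- under eq_Rintegral do rewrite ReM.
  by rewrite RintegralB ?RintegralZl //; exact: Z.
- under eq_Rintegral do rewrite ImM.
  by rewrite RintegralD ?RintegralZl //; exact: Z.
Qed.

Lemma Cintegral_sum (I : Type) (s : seq I) (F : I -> T -> Cx R) D :
  measurable D -> (forall i, cintegrable D (F i)) ->
  Cintegral mu D (fun x => \sum_(i <- s) F i x) =
    \sum_(i <- s) Cintegral mu D (F i) /\
  cintegrable D (fun x => \sum_(i <- s) F i x).
Proof.
move=> mD iF; elim: s => [|i s [IH1 IH2]].
  under eq_fun do rewrite big_nil.
  rewrite big_nil Cintegral0; split=> //.
  by split; exact: integrable0.
under eq_fun do rewrite big_cons.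
by split; [rewrite big_cons CintegralD // IH1|exact: cintegrableD].
Qed.

(** The factor 2 comes from estimating the two components separately. It is harmless: the bound is
    used only to tend to 0 or to carry a power of a small parameter. *)
Lemma cabs_Cintegral_le D f K : measurable D -> (mu D < +oo)%E ->
  cmeasurable D f -> (forall x, D x -> cabs (f x) <= K) ->
  cabs (Cintegral mu D f) <= K * fine (mu D) *+ 2.
Proof.
move=> mD muD mf fK; have [f1 f2] := cintegrable_bounded mD muD mf fK.
have B (h : T -> R) : mu.-integrable D (EFin \o h) ->
    (forall x, D x -> `|h x| <= K) -> `|\int[mu]_(x in D) h x| <= K * fine (mu D).
  move=> ih hK; rewrite -Rintegral_cst //.
  apply: le_trans (le_normr_Rintegral mD ih) _.
  apply: le_Rintegral => //; first exact: (integrable_norm ih).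
  by apply: (Rintegrable_bounded (K := `|K|)).
apply: (le_trans (cabs_le _)); rewrite mulr2n lerD //=; apply: B => // x Dx.
- exact: le_trans (normRe_le _) (fK x Dx).
- exact: le_trans (normIm_le _) (fK x Dx).
Qed.

Lemma bounded_Cintegral_cvg D (F : nat -> T -> Cx R) f K : measurable D ->
  (mu D < +oo)%E -> (forall n, cmeasurable D (F n)) ->
  (forall n x, D x -> cabs (F n x) <= K) ->
  (forall x, D x -> F ^~ x @ \oo --> f x) ->
  (fun n => Cintegral mu D (F n)) @ \oo --> Cintegral mu D f.
Proof.
move=> mD muD mF FK Ff.
have B (H : nat -> T -> R) (h : T -> R) :
    (forall n, measurable_fun D (H n)) ->
    (forall n x, D x -> `|H n x| <= K) ->
    (forall x, D x -> H ^~ x @ \oo --> h x) ->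
    (fun n => \int[mu]_(x in D) H n x) @ \oo --> \int[mu]_(x in D) h x.
  move=> mH HK Hh; apply: fine_cvg; rewrite fineK; last first.
    apply: integrable_fin_num => //; apply: (Rintegrable_bounded (K := K)) => //.
      exact: (measurable_fun_cvg mH Hh).
    move=> x Dx; apply: (cvgr_to_le (cvg_norm (Hh x Dx))).
    by apply: nearW => n; exact: HK.
  apply: (@dominated_cvg _ _ _ mu D mD (fun n x => (H n x)%:E) _ (cst K%:E)) => //.
  - by move=> n; apply/measurable_EFinP.
  - by move=> x Dx; apply: cvg_EFin; [exact: nearW|exact: Hh].
  - by apply: (Rintegrable_bounded (K := `|K|)).
apply: (@cvg_Re_Im R _ \oo).
- apply: (B (fun n x => complex.Re (F n x)) (fun x => complex.Re (f x))).
  + by move=> n; case: (mF n).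
  + by move=> n x Dx; exact: le_trans (normRe_le _) (FK n x Dx).
  + by move=> x Dx; exact: cvg_Re (Ff x Dx).
- apply: (B (fun n x => complex.Im (F n x)) (fun x => complex.Im (f x))).
  + by move=> n; case: (mF n).
  + by move=> n x Dx; exact: le_trans (normIm_le _) (FK n x Dx).
  + by move=> x Dx; exact: cvg_Im (Ff x Dx).
Qed.

End ComplexIntegral.

(** * Cauchy's theorem on half annuli *)

Section RectangleGreen.
Variable R : realType.
Local Notation leb := (@lebesgue_measure R).

Lemma is_derive_cvg (F : R -> R) (x l : R) :
  is_derive x 1 F l -> F @ x --> F x.
Proof. by move=> dF; apply/differentiable_continuous/derivable1_diffP. Qed.

Lemma Rintegral_FTC2 (f F : R -> R) (a b : R) : a < b ->
  (forall x, a <= x <= b -> f @ x --> f x) ->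
  (forall x, a <= x <= b -> is_derive x 1 F (f x)) ->
  \int[leb]_(x in `[a, b]) f x = F b - F a.
Proof.
move=> ab cf dF; rewrite /Rintegral (continuous_FTC2 (F := F)) //.
- apply: continuous_in_subspaceT => x; rewrite inE /= in_itv /=; exact: cf.
- split.
  + move=> x; rewrite in_itv /= => /andP[ax xb].
    by apply: ex_derive; apply: dF; rewrite !ltW.
  + by apply/cvg_at_right_filter/is_derive_cvg/dF; rewrite lexx ltW.
  + by apply/cvg_at_left_filter/is_derive_cvg/dF; rewrite lexx ltW.
- move=> x; rewrite in_itv /= => /andP[ax xb].
  by rewrite derive1E; apply: derive_val; apply: dF; rewrite !ltW.
Qed.

Lemma integrable_continuous_itv (f : R -> R) (a b : R) :
  (forall x, a <= x <= b -> f @ x --> f x) ->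
  leb.-integrable `[a, b] (EFin \o f).
Proof.
move=> cf; apply: continuous_compact_integrable; first exact: segment_compact.
apply: continuous_in_subspaceT => x; rewrite inE /= in_itv /=; exact: cf.
Qed.

(* Green's formula on [rho, M] x [c, d] for a field with u_t = g = v_s: the
   inner integral of v has s-derivative u(s, d) - u(s, c). *)
Lemma rectangle_green (u v g : R -> R -> R) (l r rho M c d : R) :
  c < d -> l < rho -> rho < M -> M < r ->
  (forall s t, l < s < r -> c <= t <= d -> is_derive s 1 (v ^~ t) (g s t)) ->
  (forall s t, l < s < r -> c <= t <= d -> is_derive t 1 (u s) (g s t)) ->
  (forall s t, l < s < r -> c <= t <= d ->
     (fun p => g p.1 p.2) @ (s, t) --> g s t) ->
  (forall s t, l < s < r -> c <= t <= d -> v s @ t --> v s t) ->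
  (forall s t, l < s < r -> c <= t <= d -> u ^~ t @ s --> u s t) ->
  \int[leb]_(s in `[rho, M]) (u s d - u s c) =
  \int[leb]_(t in `[c, d]) v M t - \int[leb]_(t in `[c, d]) v rho t.
Proof.
move=> cd lrho rhoM Mr dv du cg cv cu.
(* The closed range from [l'] to [r'] is compact inside the open range of the hypotheses, so [g] is
   bounded there. That bound dominates the differentiation under the integral, and the open range
   still contains [[rho, M]]. *)
pose l' := (l + rho) / 2; pose r' := (M + r) / 2.
have ll' : l < l' by rewrite /l'; lra.
have l'rho : l' < rho by rewrite /l'; lra.
have r'r : r' < r by rewrite /r'; lra.
have Mr' : M < r' by rewrite /r'; lra.
have [K gK] : exists K, forall s t, l' <= s <= r' -> c <= t <= d -> `|g s t| <= K.
  have /continuous_compact/(_ (compact_setX (@segment_compact _ l' r')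
    (@segment_compact _ c d)))/compact_bounded[K [_ gK]] :
    {within `[l', r'] `*` `[c, d], continuous (fun p => g p.1 p.2)}.
    apply: continuous_in_subspaceT => -[s t]; rewrite inE /= !in_itv /=.
    move=> [/andP[ls sr] ctd]; apply: cg => //.
    by rewrite (lt_le_trans ll') //= (le_lt_trans sr).
  exists (K + 1) => s t lsr ctd; apply: (gK (K + 1)); first by rewrite ltrDl.
  by exists (s, t) => //=; rewrite !in_itv.
pose W s := \int[leb]_(t in `[c, d]) v s t.
have sub s : l' < s < r' -> l < s < r.
  by move=> /andP[ls sr]; rewrite (lt_trans ll') //= (lt_trans sr).
have cg2 s t : l < s < r -> c <= t <= d -> g s @ t --> g s t.
  move=> lsr ctd.
  have st : (fun t => (s, t)) @ t --> (s, t).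
    exact: (cvg_pair (@cvg_cst _ s _ (nbhs t) _) (@cvg_id _ (nbhs t))).
  exact: (cvg_comp _ _ st (cg s t lsr ctd)).
have dW s : l' < s < r' -> is_derive s 1 W (u s d - u s c).
  move=> lsr.
  have Is : `]l', r'[%classic s by rewrite /= in_itv.
  have iv x : `]l', r'[%classic x -> leb.-integrable `[c, d] (EFin \o v x).
    rewrite /= in_itv /= => /sub xI; apply: integrable_continuous_itv => t.
    exact: cv.
  have dv' x t : `]l', r'[%classic x -> `[c, d]%classic t ->
      derivable (v ^~ t) x 1.
    by rewrite /= !in_itv /= => /sub xI tI; have [] := dv x t xI tI.
  have gv x t : l < x < r -> c <= t <= d -> partial1of2 v x t = g x t.
    move=> xI tI; rewrite partial1of2E; apply: derive_val; exact: dv.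
  have iK : leb.-integrable `[c, d] (EFin \o (cst `|K|)).
    by apply: integrable_continuous_itv => t _; exact: cvg_cst.
  have bK x t : `]l', r'[%classic x -> `[c, d]%classic t ->
      `|partial1of2 v x t| <= cst `|K| t.
    rewrite /= !in_itv /= => xI tI; rewrite gv //; last exact: sub.
    apply: le_trans (gK _ _ _ tI) (ler_norm _).
    by case/andP: xI => *; rewrite !ltW.
  have mcd : measurable (`[c, d]%classic : set (measurableTypeR R)).
    exact: measurable_itv.
  have K0 (y : measurableTypeR R) : 0 <= cst `|K| y by [].
  apply: DeriveDef; first exact: (derivable_under_integral mcd Is iv dv' K0 iK bK).
  rewrite -derive1E (differentiation_under_integral mcd Is iv dv' K0 iK bK).
  transitivity (\int[leb]_(t in `[c, d]) g s t).
    apply: eq_Rintegral => t; rewrite inE /= in_itv /= => tI.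
    by apply: gv => //; exact: sub.
  apply: Rintegral_FTC2 => // t; first by apply: cg2; exact: sub.
  by apply: du; exact: sub.
rewrite -[RHS]/(W M - W rho); apply: Rintegral_FTC2 => // s /andP[rs sM].
- have sI : l < s < r by apply/sub; rewrite (lt_le_trans l'rho) //= (le_lt_trans sM).
  by apply: cvgB; apply: cu => //; rewrite lexx ltW.
- by apply: dW; rewrite (lt_le_trans l'rho) //= (le_lt_trans sM).
Qed.

End RectangleGreen.

(** * Half circles in polar coordinates *)

Section ArcIntegral.
Variable R : realType.
Local Notation leb := (@lebesgue_measure R).
Local Notation arc := Defs.arc.
Implicit Types f : Cx R -> Cx R.

(** The real axis is kept because the contour runs along it. The origin is removed because the
    partial sums of the Laurent series have a pole there. *)
Definition upper_half : set (Cx R) := [set w | 0 <= complex.Im w /\ w != 0].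

Lemma cexp_iC (t : R) : cexp (iC * toC t) = Complex (cos t) (sin t).
Proof.
rewrite /cexp; have -> : iC * toC t = Complex 0 t :> Cx R.
  by apply: CxP; rewrite !ReImE /=; ring.
by rewrite /= expR0 !mul1r.
Qed.

Lemma cabs_cexp_iC (t : R) : cabs (cexp (iC * toC t)) = 1.
Proof. by rewrite cexp_iC cabsE /= cos2Dsin2 sqrtr1. Qed.

Lemma cabs_arc (s t : R) : 0 <= s -> cabs (arc s t) = s.
Proof. by move=> s0; rewrite cabsM cabs_cexp_iC mulr1 cabs_toC ger0_norm. Qed.

Lemma Im_arc (s t : R) : complex.Im (arc s t) = s * sin t.
Proof. by rewrite /arc cexp_iC ImM /= mul0r addr0. Qed.

Lemma upper_half_arc (s t : R) : 0 < s -> 0 <= t <= pi -> upper_half (arc s t).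
Proof.
move=> s0 /andP[t0 tpi]; split.
  by rewrite Im_arc; apply: mulr_ge0; [exact: ltW|apply: sin_ge0_pi; rewrite t0].
by rewrite -cabs_gt0 cabs_arc // ltW.
Qed.

Lemma arc0 (s : R) : arc s 0 = toC s.
Proof.
by rewrite /arc cexp_iC cos0 sin0; apply: CxP; rewrite !ReImE /=; ring.
Qed.

Lemma arcpi (s : R) : arc s pi = toC (- s).
Proof.
by rewrite /arc cexp_iC cospi sinpi; apply: CxP; rewrite !ReImE /=; ring.
Qed.

Lemma cderiv_toC (x : R) : cderiv (@toC R) x 1.
Proof. by split; [exact: is_derive_id|exact: is_derive_cst]. Qed.

Lemma cderiv_arg (s t : R) : cderiv (arc s) t (iC * arc s t).
Proof.
have dt : cderiv (fun t => iC * toC t) t iC.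
  have := cderivM (cderiv_cst (@iC R) t) (cderiv_toC t).
  by rewrite mul0r add0r mulr1.
have := cderivM (cderiv_cst (toC s) t) (cderiv_cexp dt).
by rewrite mul0r add0r mulrA mulrC.
Qed.

Lemma cderiv_radius (s t : R) :
  cderiv (fun s => arc s t) s (cexp (iC * toC t)).
Proof.
have := cderivM (cderiv_toC s) (cderiv_cst (cexp (iC * toC t)) s).
by rewrite mulr0 addr0 mul1r.
Qed.

Lemma cvg_polar (F : Cx R -> Cx R) (s t : R) :
  F @ (arc s t) --> F (arc s t) ->
  (fun p => F (arc p.1 p.2)) @ (s, t) --> F (arc s t).
Proof.
move=> cF; apply: (cvg_comp _ _ _ cF).
have cs : (fun p : R * R => toC p.1) @ (s, t) --> toC s.
  by apply: cvg_toC; exact: cvg_fst.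
have ct : (fun p : R * R => toC p.2) @ (s, t) --> toC t.
  by apply: cvg_toC; exact: cvg_snd.
have ci : (fun p : R * R => iC * toC p.2) @ (s, t) --> iC * toC t.
  exact: cvgM (@cvg_cst _ (@iC R) _ (nbhs (s, t)) _) ct.
exact: cvgM cs (cvg_comp _ _ ci (@cexp_continuous R _)).
Qed.

End ArcIntegral.

(** * The boundary integral of a half annulus *)

Section Contour.
Variable R : realType.
Local Notation leb := (@lebesgue_measure R).
Local Notation arc := Defs.arc.
Implicit Types f : Cx R -> Cx R.

Lemma upper_half_toC (s : R) : s != 0 -> upper_half (toC s).
Proof. by move=> s0; split => //=; rewrite -cabs_gt0 cabs_toC normr_gt0. Qed.

Let opposite_integral (h : R -> R) (a b : R) : a <= b ->
  (forall x, - b <= x <= - a -> h @ x --> h x) ->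
  \int[leb]_(x in `[- b, - a]) h x = \int[leb]_(x in `[a, b]) h (- x).
Proof.
move=> ab ch; congr fine; apply: integration_by_substitution_oppr => //.
by apply: continuous_in_subspaceT => x; rewrite inE /= in_itv /=; exact: ch.
Qed.

(* The component pr is the real or the imaginary part: in polar coordinates,
   Cauchy-Riemann turns d/dt (f(w) e^(it)) into d/ds (i w f(w)), where
   w = s e^(it). *)
Let half_annulus_component f (pr : Cx R -> R) (rho M : R) :
  (forall z w, pr (z + w) = pr z + pr w) ->
  (forall phi x l, cderiv phi x l ->
     is_derive x 1 (fun t => pr (phi t)) (pr l)) ->
  continuous pr ->
  0 < rho -> rho < M -> c1_on (@upper_half R) f ->
  \int[leb]_(s in `[rho, M]) pr (f (toC s)) +
  \int[leb]_(s in `[- M, - rho]) pr (f (toC s)) =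
  \int[leb]_(t in `[0, pi]) pr (f (arc rho t) * (iC * arc rho t)) -
  \int[leb]_(t in `[0, pi]) pr (f (arc M t) * (iC * arc M t)).
Proof.
move=> prD prd prc rho0 rhoM [f' [fd fc fc']].
have prN z : pr (- z) = - pr z.
  have pr0 : pr 0 = 0 by apply: (addrI (pr 0)); rewrite -prD !addr0.
  by apply: (addrI (pr z)); rewrite -prD !subrr.
pose e (t : R) : Cx R := cexp (iC * toC t).
pose V s t := pr (f (arc s t) * (iC * arc s t)).
pose U s t := pr (f (arc s t) * e t).
pose G (s t : R) := f' (arc s t) * (iC * arc s t) * e t + f (arc s t) * (iC * e t).
have e1 t : e t = arc 1 t by rewrite /arc toC1 mul1r.
(* The numbers [rho / 2] and [M + 1] are arbitrary: [rectangle_green] asks for an open range of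
   radii around [[rho, M]], and here it must also avoid 0. *)
have D s t : rho / 2 < s < M + 1 -> 0 <= t <= pi -> upper_half (arc s t).
  move=> /andP[rs _]; apply: upper_half_arc.
  by rewrite (lt_trans _ rs) // divr_gt0.
have dV s t : rho / 2 < s < M + 1 -> 0 <= t <= pi ->
    is_derive s 1 (V ^~ t) (pr (G s t)).
  move=> sI tI; apply: prd.
  have dr := cderiv_radius s t.
  have := cderivM (fd (fun s => arc s t) s _ (D s t sI tI) dr)
    (cderivM (cderiv_cst (@iC R) s) dr).
  by rewrite mul0r add0r /G; congr cderiv; rewrite /e; ring.
have dU s t : rho / 2 < s < M + 1 -> 0 <= t <= pi ->
    is_derive t 1 (U s) (pr (G s t)).
  move=> sI tI; apply: prd.
  have de : cderiv e t (iC * e t).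
    have := cderiv_arg 1 t; rewrite -e1; congr cderiv.
    by apply/funext => t'; rewrite e1.
  exact: cderivM (fd (arc s) t _ (D s t sI tI) (cderiv_arg s t)) de.
have pol (F : Cx R -> Cx R) s t : F @ (arc s t) --> F (arc s t) ->
  (fun p => F (arc p.1 p.2)) @ (s, t) --> F (arc s t) by exact: cvg_polar.
have cG s t : rho / 2 < s < M + 1 -> 0 <= t <= pi ->
    (fun p => pr (G p.1 p.2)) @ (s, t) --> pr (G s t).
  move=> sI tI; have Dst := D s t sI tI.
  have cf := pol f s t (fc _ Dst); have cf' := pol f' s t (fc' _ Dst).
  have ca := pol id s t (@cvg_id _ (nbhs (arc s t))).
  have ci : (fun p : R * R => @iC R) @ (s, t) --> @iC R.
    exact: (@cvg_cst _ (@iC R) _ (nbhs (s, t))).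
  have ce : (fun p : R * R => e p.2) @ (s, t) --> e t.
    have c2 : (fun p : R * R => (1, p.2)) @ (s, t) --> (1 : R, t).
      exact: (cvg_pair (@cvg_cst _ (1 : R) _ (nbhs (s, t)) _) cvg_snd).
    rewrite e1; under eq_fun do rewrite e1.
    exact: (cvg_comp _ _ c2 (@cvg_polar R id 1 t (@cvg_id _ (nbhs (arc 1 t))))).
  have cG : (fun p => G p.1 p.2) @ (s, t) --> G s t.
    exact: cvgD (cvgM (cvgM cf' (cvgM ci ca)) ce) (cvgM cf (cvgM ci ce)).
  exact: (cvg_comp _ _ cG (prc _)).
have cV s t : rho / 2 < s < M + 1 -> 0 <= t <= pi -> V s @ t --> V s t.
  move=> sI tI.
  have st : (fun t => (s, t)) @ t --> (s, t).
    exact: (cvg_pair (@cvg_cst _ s _ (nbhs t) _) (@cvg_id _ (nbhs t))).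
  have cf : (fun t => f (arc s t)) @ t --> f (arc s t).
    exact: (cvg_comp _ _ st (pol f s t (fc _ (D s t sI tI)))).
  have ca : (fun t => arc s t) @ t --> arc s t.
    exact: (cvg_comp _ _ st (pol id s t (@cvg_id _ (nbhs (arc s t))))).
  have ci : (fun=> @iC R) @ t --> @iC R by exact: (@cvg_cst _ _ _ (nbhs t)).
  have cfa : (fun t => f (arc s t) * (iC * arc s t)) @ t -->
      f (arc s t) * (iC * arc s t) by exact: cvgM cf (cvgM ci ca).
  exact: (cvg_comp _ _ cfa (prc _)).
have cU s t : rho / 2 < s < M + 1 -> 0 <= t <= pi -> U ^~ t @ s --> U s t.
  move=> sI tI.
  have st : (fun s => (s, t)) @ s --> (s, t).
    exact: (cvg_pair (@cvg_id _ (nbhs s)) (@cvg_cst _ t _ (nbhs s) _)).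
  have cf : (fun s => f (arc s t)) @ s --> f (arc s t).
    exact: (cvg_comp _ _ st (pol f s t (fc _ (D s t sI tI)))).
  have ce : (fun=> e t) @ s --> e t by exact: (@cvg_cst _ _ _ (nbhs s)).
  have cfe : (fun s => f (arc s t) * e t) @ s --> f (arc s t) * e t.
    exact: cvgM cf ce.
  exact: (cvg_comp _ _ cfe (prc _)).
have pi0 : 0 < pi :> R by exact: pi_gt0.
have rho2 : rho / 2 < rho by rewrite ltr_pdivrMr // mulr_natr mulr2n ltrDl.
have M1 : M < M + 1 by rewrite ltrDl.
have := rectangle_green pi0 rho2 rhoM M1 dV dU cG cV cU.
have cline x : x != 0 -> (fun x => pr (f (toC x))) @ x --> pr (f (toC x)).
  move=> x0; have ct : (@toC R) @ x --> toC x.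
    exact: (cvg_toC (@cvg_id _ (nbhs x))).
  have cf : (fun x => f (toC x)) @ x --> f (toC x).
    exact: (cvg_comp _ _ ct (fc _ (upper_half_toC x0))).
  exact: (cvg_comp _ _ cf (prc _)).
have pos x : rho <= x <= M -> x != 0.
  by move=> /andP[rx _]; rewrite gt_eqF // (lt_le_trans rho0).
have neg x : - M <= x <= - rho -> x != 0.
  by move=> /andP[_ xr]; rewrite lt_eqF // (le_lt_trans xr) // oppr_lt0.
(* At angle [pi] both the point and the direction of the ray change sign, so the two straight sides
   of the polar rectangle become the segments on the positive and the negative axis. *)
have UE s : U s pi - U s 0 = - (pr (f (toC s)) + pr (f (toC (- s)))).
  have epi : e pi = -1 by rewrite e1 arcpi toCN.
  have e0 : e 0 = 1 by rewrite e1 arc0.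
  by rewrite /U epi e0 arc0 arcpi mulrN1 mulr1 prN opprD addrC.
under eq_Rintegral do rewrite UE.
rewrite -[X in X = _ -> _]opprK => eqI.
rewrite -[RHS]opprB -eqI.
rewrite (opposite_integral (h := fun x => pr (f (toC x)))) ?(ltW rhoM) //; last first.
  by move=> x /neg /cline.
have i1 : leb.-integrable `[rho, M] (EFin \o (fun x => pr (f (toC x)))).
  by apply: integrable_continuous_itv => x /pos /cline.
have i2 : leb.-integrable `[rho, M] (EFin \o (fun x => pr (f (toC (- x))))).
  apply: integrable_continuous_itv => x /pos x0.
  have xN : - x != 0 by rewrite oppr_eq0.
  have oc : (fun y : R => - y) @ x --> - x by exact: opp_continuous.
  exact: (cvg_comp _ _ oc (cline _ xN)).
rewrite -RintegralD // opprK -mulN1r -RintegralZl //; last first.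
  have iN mD := integrableN (integrableD mD i1 i2).
  exact: iN.
by apply: eq_Rintegral => x _; rewrite mulN1r opprK.
Qed.

Lemma half_annulus_cauchy f (rho M : R) : 0 < rho -> rho < M ->
  c1_on (@upper_half R) f ->
  Cintegral leb `[rho, M] (fun s => f (toC s)) +
  Cintegral leb `[- M, - rho] (fun s => f (toC s)) =
  arc_integral rho f - arc_integral M f.
Proof.
move=> rho0 rhoM cf; apply: CxP; rewrite !ReImE /=.
- apply: (@half_annulus_component f (@complex.Re R)) => //.
  + exact: ReD.
  + by move=> phi x l [].
  + by move=> z; exact: (@cvg_Re R _ (nbhs z) _ id z).
- apply: (@half_annulus_component f (@complex.Im R)) => //.
  + exact: ImD.
  + by move=> phi x l [].
  + by move=> z; exact: (@cvg_Im R _ (nbhs z) _ id z).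
Qed.

End Contour.

(** * Laurent series with absolutely summable coefficients *)

Section LaurentSeries.
Variable R : realType.

Lemma dominated_series_cvg (u : nat -> Cx R) (v : nat -> R) :
  (forall n, cabs (u n) <= v n) -> cvgn (series v) ->
  exists l : Cx R, series u @ \oo --> l.
Proof.
move=> uv cv.
have dom (h : nat -> R) : (forall n, `|h n| <= v n) -> cvgn (series h).
  move=> hv; apply: normed_cvg; apply: (series_le_cvg _ _ hv cv) => n //=.
  exact: le_trans (hv n).
have [/cvg_ex[lr cr] /cvg_ex[li ci]] : cvgn (series (fun n => complex.Re (u n))) /\
    cvgn (series (fun n => complex.Im (u n))).
  split; apply: dom => n.
  - exact: le_trans (normRe_le _) (uv n).
  - exact: le_trans (normIm_le _) (uv n).
exists (Complex lr li); apply: (@cvg_Re_Im R _ \oo) => /=.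
- by under eq_fun do rewrite /series /= Re_sum.
- by under eq_fun do rewrite /series /= Im_sum.
Qed.

Variables (a : nat -> R) (rho : R).
Hypothesis rho_gt0 : 0 < rho.
Hypothesis summable : cvgn (fun N => \sum_(2 <= n < N) `|a n / rho ^+ n|).

Definition laurent_sum (N : nat) (w : Cx R) : Cx R :=
  \sum_(2 <= n < N) toC (a n) / w ^+ n.

(** This is the constant in the decay B / |w|^2 of [p] and of all its partial sums. The factor
    [rho ^+ 2] is what remains of [(rho / cabs w) ^+ 2] once [cabs w ^+ 2] is split off. *)
Definition laurent_bound : R :=
  limn (fun N => \sum_(2 <= n < N) `|a n / rho ^+ n|) * rho ^+ 2.

(** Convergence criteria are stated for [series], which starts at 0, so the two missing terms are
    filled with 0. *)
Lemma sum_from2 (V : zmodType) (F : nat -> V) N :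
  \sum_(2 <= n < N) F n = series (fun n => if (2 <= n)%N then F n else 0) N.
Proof. by rewrite (big_nat_widenl 2 0) // big_mkcond. Qed.

Let dominating n : R := if (2 <= n)%N then `|a n / rho ^+ n| else 0.

(** Since [rho / cabs w] is at most 1, its power of exponent [n] is largest at the smallest
    admissible exponent, which is 2. *)
Lemma laurent_term_le (w : Cx R) n : rho <= cabs w -> (2 <= n)%N ->
  cabs (toC (a n) / w ^+ n) <= `|a n / rho ^+ n| * (rho / cabs w) ^+ 2.
Proof.
move=> rw n2; have w0 : 0 < cabs w by exact: lt_le_trans rw.
rewrite cabsM cabsV cabsX cabs_toC normrM normfV (ger0_norm (exprn_ge0 _ (ltW rho_gt0))).
rewrite -mulrA ler_wpM2l // -(subnK n2); set k := (n - 2)%N.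
have -> : (rho ^+ (k + 2))^-1 * (rho / cabs w) ^+ 2 =
    (rho ^+ k)^-1 * (cabs w ^+ 2)^-1.
  by rewrite exprD; field; rewrite expf_neq0 ?gt_eqF.
rewrite exprD invfM ler_wpM2r ?invr_ge0 ?exprn_ge0 ?(ltW w0) //.
by rewrite lef_pV2 ?posrE ?exprn_gt0 // lerXn2r ?nnegrE // ltW.
Qed.

Lemma cabs_laurent_sum (w : Cx R) N : rho <= cabs w ->
  cabs (laurent_sum N w) <= laurent_bound / cabs w ^+ 2.
Proof.
move=> rw; apply: (le_trans (cabs_sum _ _ _)).
apply: (@le_trans _ _
   (\sum_(2 <= n < N) `|a n / rho ^+ n| * (rho / cabs w) ^+ 2)).
  rewrite big_nat_cond [leRHS]big_nat_cond; apply: ler_sum => n.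
  by rewrite andbT => /andP[n2 _]; exact: laurent_term_le.
rewrite -mulr_suml /laurent_bound expr_div_n -[leRHS]mulrA.
rewrite ler_wpM2r ?mulr_ge0 ?invr_ge0 ?exprn_ge0 ?cabs_ge0 ?(ltW rho_gt0) //.
apply: (@nondecreasing_cvgn_le _ (fun N => \sum_(2 <= n < N) `|a n / rho ^+ n|)) => //.
exact: nondecreasing_series.
Qed.

(** Absolute convergence on the circle of radius [rho] dominates the series at every point outside
    it, so the [limn] inside [inv_series] is a genuine limit there. *)
Lemma laurent_sum_cvg (w : Cx R) : rho <= cabs w ->
  (fun N => laurent_sum N w) @ \oo --> inv_series (fun k => toC (a k)) w.
Proof.
move=> rw.
have [] := @dominated_series_cvg
  (fun n => if (2 <= n)%N then toC (a n) / w ^+ n else 0) dominating.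
- move=> n; rewrite /dominating; case: ifP => n2; last by rewrite cabs0.
  apply: (le_trans (laurent_term_le rw n2)).
  rewrite ler_piMr // exprn_ile1 ?divr_ge0 ?cabs_ge0 ?(ltW rho_gt0) //.
  by rewrite ler_pdivrMr ?mul1r // (lt_le_trans rho_gt0).
- by move: summable; under eq_fun do rewrite sum_from2.
- move=> l cl; have {}cl : (fun N => laurent_sum N w) @ \oo --> l.
    by under eq_fun do rewrite /laurent_sum sum_from2.
  exact: cvgP cl.
Qed.

Lemma cabs_inv_series (w : Cx R) : rho <= cabs w ->
  cabs (inv_series (fun k => toC (a k)) w) <= laurent_bound / cabs w ^+ 2.
Proof.
move=> rw; apply: (cvgr_to_le (cvg_cabs (laurent_sum_cvg rw))).
by apply: nearW => N; exact: cabs_laurent_sum.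
Qed.

Lemma laurent_sum_toC (x : R) N :
  laurent_sum N (toC x) = toC (\sum_(2 <= n < N) a n / x ^+ n).
Proof.
by rewrite toC_sum; apply: eq_bigr => n _; rewrite toCM toCV toCX.
Qed.

Lemma inv_series_real_cvg (x : R) : rho <= `|x| ->
  (fun N => \sum_(2 <= n < N) a n / x ^+ n) @ \oo --> inv_series a x.
Proof.
rewrite -cabs_toC => /laurent_sum_cvg /cvg_Re.
under eq_fun do rewrite laurent_sum_toC /=.
by move=> /cvgP.
Qed.

(** Links the density of [lam], given by the real series, to the complex series that is integrated
    over the arc. *)
Lemma inv_series_toC (x : R) : rho <= `|x| ->
  inv_series (fun k => toC (a k)) (toC x) = toC (inv_series a x).
Proof.
move=> rx; have /cvg_toC ct := inv_series_real_cvg rx.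
rewrite /inv_series; apply: cvg_lim => //.
by under eq_fun do rewrite -/(laurent_sum _ _) laurent_sum_toC.
Qed.

Lemma c1_laurent_sum N : c1_on (@upper_half R) (laurent_sum N).
Proof.
apply: c1_sum => n; apply: c1M; first exact: c1_cst.
apply: c1V => [w [_ w0]|]; first exact: expf_neq0.
exact/c1X/c1_id.
Qed.

End LaurentSeries.

(** * Integration against the measure with density p *)

Section Density.
Context d (T : measurableType d) (R : realType).
Variables (mu nu : {measure set T -> \bar R}) (g : T -> R).
Hypothesis mg : measurable_fun setT g.
Hypothesis g_ge0 : forall x, 0 <= g x.
Hypothesis nuE : forall A, measurable A -> nu A = (\int[mu]_(x in A) (g x)%:E)%E.

Import HBNNSimple.
Local Open Scope ereal_scope.

(** On each level set of [h] the claim is [nuE]; a simple function is a finite combination of such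
    indicators. *)
Lemma integral_density_nnsfun (h : {nnsfun T >-> R}) :
  \int[nu]_x (h x)%:E = \int[mu]_x ((h x)%:E * (g x)%:E).
Proof.
have mind y : measurable_fun setT (fun x => (\1_(h @^-1` [set y]) x)%:E : \bar R).
  exact/measurable_EFinP.
under [RHS]eq_integral => x _.
  rewrite fimfunE -fsumEFin // ge0_mule_fsuml; last first.
    by move=> y; rewrite EFinM; exact: nnfun_muleindic_ge0.
  over.
rewrite ge0_integral_fsum //; last 2 first.
- move=> y; apply: emeasurable_funM; last exact/measurable_EFinP.
  by apply/measurable_EFinP; apply: measurable_funM.
- by move=> y x _; rewrite EFinM mule_ge0 ?nnfun_muleindic_ge0 // lee_fin.
rewrite integralT_nnsfun sintegralE; apply: eq_fsbigr => y; rewrite inE => -[x0 _ <-].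
rewrite nuE // integral_mkcond.
rewrite -ge0_integralZl //; last 3 first.
- apply/(measurable_restrictT _ _).1 => //.
  by apply: measurable_funTS; exact/measurable_EFinP.
- by move=> x _; apply: erestrict_ge0 => t _; rewrite lee_fin.
- by rewrite lee_fin.
apply: eq_integral => x _; rewrite epatch_indic EFinM -muleA; congr (_ * _).
exact: muleC.
Qed.

Lemma ge0_integral_density (f : T -> \bar R) : measurable_fun setT f ->
  (forall x, 0 <= f x) -> \int[nu]_x f x = \int[mu]_x (f x * (g x)%:E).
Proof.
move=> mf f0; pose h := nnsfun_approx measurableT mf.
have fh x : (fun n => (h n x)%:E) @ \oo --> f x by exact: cvg_nnsfun_approx.
have ndh x : {homo (fun n => (h n x)%:E) : m n / (m <= n)%N >-> m <= n}.
  by move=> m n mn; rewrite lee_fin; exact/lefP/nd_nnsfun_approx.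
have mh n : measurable_fun setT (fun x => (h n x)%:E) by exact/measurable_EFinP.
have cnu : (fun n => \int[nu]_x (h n x)%:E) @ \oo --> \int[nu]_x f x.
  rewrite (_ : \int[nu]_x f x =
      \int[nu]_x limn (fun n => (h n x)%:E)); last first.
    by apply: eq_integral => x _; rewrite (cvg_lim _ (fh x)).
  apply: (@cvg_monotone_convergence _ _ _ nu setT _ (fun n x => (h n x)%:E)) => //.
  by move=> n x _; rewrite lee_fin.
have cmu : (fun n => \int[mu]_x ((h n x)%:E * (g x)%:E)) @ \oo -->
    \int[mu]_x (f x * (g x)%:E).
  have fgh x : (fun n => (h n x)%:E * (g x)%:E) @ \oo --> f x * (g x)%:E.
    by apply: cvgeZr => //; exact: fh.
  rewrite (_ : \int[mu]_x (f x * (g x)%:E) =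
      \int[mu]_x limn (fun n => (h n x)%:E * (g x)%:E)); last first.
    by apply: eq_integral => x _; rewrite (cvg_lim _ (fgh x)).
  apply: (@cvg_monotone_convergence _ _ _ mu setT _
    (fun n x => (h n x)%:E * (g x)%:E)) => // [n|n x _|x _ m n mn].
  - by apply: emeasurable_funM; [exact: mh|exact/measurable_EFinP].
  - by rewrite mule_ge0 ?lee_fin.
  - by rewrite lee_wpmul2r ?lee_fin //; exact: ndh.
rewrite (_ : (fun n => \int[nu]_x (h n x)%:E) =
    (fun n => \int[mu]_x ((h n x)%:E * (g x)%:E))) in cnu; last first.
  by apply/funext => n; exact: integral_density_nnsfun.
exact: (cvg_unique _ cnu cmu).
Qed.

(** Because [g] is nonnegative, multiplying by it commutes with taking positive and negative parts,
    and these have equal extended integrals on both sides. Hence the two real integrals agree even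
    when [f] is not integrable, since [fine] is then applied to the same value. *)
Lemma Rintegral_density (D : set T) (f : T -> R) : measurable D ->
  measurable_fun D f ->
  (\int[nu]_(x in D) f x = \int[mu]_(x in D) (f x * g x))%R.
Proof.
move=> mD mf; congr fine.
have ge0_case (k : T -> \bar R) : measurable_fun D k ->
    (forall x, 0 <= k x) ->
    \int[nu]_(x in D) k x = \int[mu]_(x in D) (k x * (g x)%:E).
  move=> mk k0; rewrite integral_mkcond [RHS]integral_mkcond.
  rewrite ge0_integral_density.
  - apply: eq_integral => x _; rewrite /patch; case: ifP => // _.
    by rewrite mul0e.
  - exact/(measurable_restrictT _ _).1.
  - by move=> x; apply: erestrict_ge0 => t _.
have mfE : measurable_fun D (EFin \o f) by exact/measurable_EFinP.
rewrite integralE [RHS]integralE !ge0_case //; last 2 first.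
- exact: measurable_funeneg.
- exact: measurable_funepos.
congr (_ - _); apply: eq_integral => x _; rewrite ?funeposE ?funenegE /=.
- rewrite -!EFin_max -EFinM; congr EFin.
  by rewrite maxr_pMl ?mul0r.
- by rewrite -!EFin_max -EFinM; congr EFin; rewrite maxr_pMl // mul0r mulNr.
Qed.

End Density.

(** * Moving integrals from the real line to the half circle *)

Section LineIntegral.
Variable R : realType.
Local Notation leb := (@lebesgue_measure R).
Local Notation arc := Defs.arc.

(** Unlike [upper_half] this contains the origin: the kernels are regular there, and the windows
    [[- M, M]] run across it. *)
Definition closed_upper : set (Cx R) := [set w | 0 <= complex.Im w].

Lemma c1_on_subset (D E : set (Cx R)) (f : Cx R -> Cx R) : E `<=` D ->
  c1_on D f -> c1_on E f.
Proof.
move=> ED [f' [fd fc fc']]; exists f'; split => [phi x l Ex|w Ew|w Ew].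
- by apply: fd; exact: ED.
- by apply: fc; exact: ED.
- by apply: fc'; exact: ED.
Qed.

Lemma cmeasurable_continuous (D : set (measurableTypeR R)) (f : R -> Cx R) :
  measurable D -> (forall x, D x -> f @ x --> f x) -> cmeasurable D f.
Proof.
move=> mD cf; split; apply: subspace_continuous_measurable_fun => //;
  apply: continuous_in_subspaceT => x; rewrite inE => /cf.
- exact: cvg_Re.
- exact: cvg_Im.
Qed.

Lemma lebesgue_itv_lty (a b : R) : (leb `[a, b]%classic < +oo)%E.
Proof.
by rewrite lebesgue_measure_itv /=; case: ifPn => // _; rewrite -EFinB ltry.
Qed.

Lemma c1_on_line_cvg (D : set (Cx R)) (f : Cx R -> Cx R) (x : R) :
  c1_on D f -> D (toC x) -> (fun x => f (toC x)) @ x --> f (toC x).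
Proof.
move=> [f' [_ fc _]] Dx.
have ct : (@toC R) @ x --> toC x by exact: (cvg_toC (@cvg_id _ (nbhs x))).
exact: (cvg_comp _ _ ct (fc _ Dx)).
Qed.

Lemma c1_on_arc_cvg (D : set (Cx R)) (f : Cx R -> Cx R) (s t : R) :
  c1_on D f -> D (arc s t) ->
  (fun t => f (arc s t) * (iC * arc s t)) @ t --> f (arc s t) * (iC * arc s t).
Proof.
move=> [f' [_ fc _]] Dt.
have ca : (arc s) @ t --> arc s t by exact: cderiv_cvg (cderiv_arg s t).
have cf : (fun t => f (arc s t)) @ t --> f (arc s t).
  exact: (cvg_comp _ _ ca (fc _ Dt)).
have ci : (fun=> @iC R) @ t --> @iC R by exact: (@cvg_cst _ _ _ (nbhs t)).
exact: cvgM cf (cvgM ci ca).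
Qed.

Variables (a : nat -> R) (rho : R).
Hypothesis rho_gt0 : 0 < rho.
Hypothesis summable : cvgn (fun N => \sum_(2 <= n < N) `|a n / rho ^+ n|).

Local Notation P := (inv_series (fun k => toC (a k))).
Local Notation PN := (laurent_sum a).
Local Notation B := (laurent_bound a rho).

Lemma laurent_bound_ge0 : 0 <= B.
Proof.
have := cabs_laurent_sum rho_gt0 summable 0 (w := toC rho).
rewrite cabs_toC gtr0_norm // lexx => /(_ isT) /(le_trans (cabs_ge0 _)).
by rewrite pmulr_lge0 // invr_gt0 exprn_gt0.
Qed.

Lemma laurent_bound_mono (s t : R) : 0 < s -> s <= t -> B / t ^+ 2 <= B / s ^+ 2.
Proof.
move=> s0 st; rewrite ler_wpM2l ?laurent_bound_ge0 //.
have t0 := lt_le_trans s0 st.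
by rewrite lef_pV2 ?posrE ?exprn_gt0 // lerXn2r ?nnegrE // ltW.
Qed.

Variables (h : Cx R -> Cx R) (K : R).
Hypothesis ch : c1_on closed_upper h.
Hypothesis hK : forall w, closed_upper w -> cabs (h w) <= K.

Let upper_closed : @upper_half R `<=` closed_upper.
Proof. by move=> w []. Qed.

Let hP w : Cx R := h w * P w.

Let c1hPN N : c1_on (@upper_half R) (fun w => h w * PN N w).
Proof. exact: c1M (c1_on_subset upper_closed ch) (c1_laurent_sum a N). Qed.

Let hPN_cvg w : rho <= cabs w -> (fun N => h w * PN N w) @ \oo --> hP w.
Proof.
move=> rw; apply: (@cvgM _ _ \oo); first exact: cvg_cst.
exact: (laurent_sum_cvg rho_gt0 summable).
Qed.

Let hPN_le (s : R) N w : closed_upper w -> rho <= s -> s <= cabs w ->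
  cabs (h w * PN N w) <= K * (B / s ^+ 2).
Proof.
move=> uw rs sw; have rw := le_trans rs sw.
rewrite cabsM ler_pM ?cabs_ge0 ?hK //.
apply: (le_trans (cabs_laurent_sum rho_gt0 summable N rw)).
by apply: laurent_bound_mono => //; exact: lt_le_trans rs.
Qed.

Let hP_le (s : R) w : closed_upper w -> rho <= s -> s <= cabs w ->
  cabs (hP w) <= K * (B / s ^+ 2).
Proof.
move=> uw rs sw; apply: (cvgr_to_le (cvg_cabs (hPN_cvg (le_trans rs sw)))).
by apply: nearW => N; exact: hPN_le.
Qed.

Let line_cmeasurable N (D : set (measurableTypeR R)) : measurable D ->
  (forall x, D x -> rho <= `|x|) ->
  cmeasurable D (fun x => h (toC x) * PN N (toC x)).
Proof.
move=> mD uv; apply: cmeasurable_continuous => // x /uv rx.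
apply: (c1_on_line_cvg (c1hPN N)); apply: upper_half_toC.
by rewrite -normr_gt0 (lt_le_trans rho_gt0).
Qed.

Let arc_cmeasurable N (s : R) : 0 < s ->
  cmeasurable (`[0, pi]%classic : set (measurableTypeR R))
    (fun t => h (arc s t) * PN N (arc s t) * (iC * arc s t)).
Proof.
move=> s0; apply: cmeasurable_continuous => // t; rewrite /= in_itv /= => tI.
by apply: (c1_on_arc_cvg (c1hPN N)); exact: upper_half_arc.
Qed.

Let segment_cvg (u v : R) : (forall x, u <= x <= v -> rho <= `|x|) ->
  (fun N => Cintegral leb `[u, v] (fun x => h (toC x) * PN N (toC x))) @ \oo -->
  Cintegral leb `[u, v] (fun x => hP (toC x)).
Proof.
move=> uv; apply: (bounded_Cintegral_cvg (K := K * (B / rho ^+ 2))) => //.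
- exact: lebesgue_itv_lty.
- by move=> N; apply: line_cmeasurable => // x; rewrite /= in_itv; exact: uv.
- move=> N x; rewrite /= in_itv /= => /uv rx.
  by apply: hPN_le; rewrite ?cabs_toC //= /closed_upper /=.
- by move=> x; rewrite /= in_itv /= => /uv rx; apply: hPN_cvg; rewrite cabs_toC.
Qed.

Let arc_closed_upper (s t : R) : 0 < s -> 0 <= t <= pi -> closed_upper (arc s t).
Proof. by move=> s0 tI; apply/upper_closed/upper_half_arc. Qed.

Let arc_cvg (s : R) : rho <= s ->
  (fun N => arc_integral s (fun w => h w * PN N w)) @ \oo --> arc_integral s hP.
Proof.
move=> rs; have s0 := lt_le_trans rho_gt0 rs.
apply: (bounded_Cintegral_cvg (K := K * (B / s ^+ 2) * s)) => //.
- exact: lebesgue_itv_lty.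
- by move=> N; exact: arc_cmeasurable.
- move=> N t; rewrite /= in_itv /= => tI.
  rewrite cabsM [cabs (iC * _)]cabsM cabs_iC mul1r (cabs_arc _ (ltW s0)).
  rewrite ler_wpM2r ?(ltW s0) //; apply: hPN_le => //.
    exact: arc_closed_upper.
  by rewrite cabs_arc // ltW.
- move=> t; rewrite /= in_itv /= => tI; apply: (@cvgM _ _ \oo).
    by apply: hPN_cvg; rewrite cabs_arc // ltW.
  exact: cvg_cst.
Qed.

(** The bounds [hPN_le] on segments and arcs do not depend on [N], so Cauchy's theorem for the
    partial sums passes to the limit on both sides. *)
Let segments_eq_arcs (M : R) : rho < M ->
  Cintegral leb `[rho, M] (fun x => hP (toC x)) +
  Cintegral leb `[- M, - rho] (fun x => hP (toC x)) =
  arc_integral rho hP - arc_integral M hP.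
Proof.
move=> rM.
have c1 : (fun N => Cintegral leb `[rho, M] (fun x => h (toC x) * PN N (toC x)) +
      Cintegral leb `[- M, - rho] (fun x => h (toC x) * PN N (toC x))) @ \oo -->
    Cintegral leb `[rho, M] (fun x => hP (toC x)) +
    Cintegral leb `[- M, - rho] (fun x => hP (toC x)).
  apply: (@cvgD _ (Cx R) _ \oo); apply: segment_cvg => x /andP[x1 x2].
  - exact: le_trans x1 (ler_norm x).
  - by rewrite -normrN; apply: le_trans (ler_norm _); rewrite lerNr.
have c2 : (fun N => arc_integral rho (fun w => h w * PN N w) -
    arc_integral M (fun w => h w * PN N w)) @ \oo -->
    arc_integral rho hP - arc_integral M hP.
  exact: cvgB (arc_cvg (lexx rho)) (arc_cvg (ltW rM)).
rewrite (_ : (fun N => _) = (fun N => arc_integral rho (fun w => h w * PN N w) -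
    arc_integral M (fun w => h w * PN N w))) in c1.
  exact: (cvg_unique _ c1 c2).
apply/funext => N.
exact: (half_annulus_cauchy rho_gt0 rM (c1hPN N)).
Qed.

Let hP_line_cmeasurable (D : set (measurableTypeR R)) : measurable D ->
  (forall x, D x -> rho <= `|x|) -> cmeasurable D (fun x => hP (toC x)).
Proof.
move=> mD Dr; apply: (cmeasurable_cvg mD (fun N => line_cmeasurable N mD Dr)).
by move=> x /Dr rx; apply: hPN_cvg; rewrite cabs_toC.
Qed.

Lemma inv_series_arc_cmeasurable (s : R) : rho <= s ->
  cmeasurable (`[0, pi]%classic : set (measurableTypeR R))
    (fun t => hP (arc s t) * (iC * arc s t)).
Proof.
move=> rs; have s0 := lt_le_trans rho_gt0 rs.
apply: (cmeasurable_cvg _ (fun N => arc_cmeasurable N s0)) => // t.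
move=> _; apply: (@cvgM _ _ \oo); last exact: cvg_cst.
by apply: hPN_cvg; rewrite cabs_arc // ltW.
Qed.

(** The velocity of the arc contributes a factor [s] and the decay of [p] a factor 1 / s^2. The
    remaining 1 / s is what makes large arcs vanish. *)
Lemma cabs_inv_series_arc_le (s t : R) : rho <= s -> 0 <= t <= pi ->
  cabs (hP (arc s t) * (iC * arc s t)) <= K * B / s.
Proof.
move=> rs tI; have s0 := lt_le_trans rho_gt0 rs.
rewrite cabsM [cabs (iC * _)]cabsM cabs_iC mul1r (cabs_arc _ (ltW s0)).
apply: (@le_trans _ _ (K * (B / s ^+ 2) * s)); last first.
  by rewrite le_eqVlt; apply/orP; left; apply/eqP; field; rewrite gt_eqF.
rewrite ler_wpM2r ?(ltW s0) //; apply: hP_le => //; first exact: arc_closed_upper.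
by rewrite cabs_arc // ltW.
Qed.

Lemma arc_integral_inv_series_cvg0 :
  (fun n => arc_integral (rho + n.+1%:R) hP) @ \oo --> (0 : Cx R).
Proof.
pose c := K * B * fine (leb `[0, pi]%classic) *+ 2.
apply/cvg_cabsP => e e0; near=> n.
have rM : rho <= rho + n.+1%:R by rewrite lerDl.
have M0 : 0 < rho + n.+1%:R by exact: lt_le_trans rM.
rewrite add0r cabsN; apply: (@le_lt_trans _ _ (c / (rho + n.+1%:R))).
  rewrite (_ : c / _ = K * B / (rho + n.+1%:R) * fine (leb `[0, pi]%classic) *+ 2);
    last by rewrite /c mulrnAl; congr (_ *+ 2); ring.
  apply: cabs_Cintegral_le => //; first exact: lebesgue_itv_lty.
    exact: inv_series_arc_cmeasurable.
  by move=> t; rewrite /= in_itv /= => tI; exact: cabs_inv_series_arc_le.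
rewrite ltr_pdivrMr // mulrC -ltr_pdivrMr //.
apply: (@lt_le_trans _ _ n%:R); first by near: n; exact: nbhs_infty_gtr.
by rewrite -natr1; have := rho_gt0; lra.
Unshelve. all: by end_near. Qed.

Variable lam : {measure set (measurableTypeR R) -> \bar R}.
Hypothesis p_ge0 : forall x : R, rho <= `|x| -> 0 <= inv_series a x.
Let S : set (measurableTypeR R) := [set y : R | (rho <= `|y|)%R].
Hypothesis lam_density : forall A : set (measurableTypeR R), measurable A ->
  lam A = (\int[leb]_(x in A) (inv_series a x * \1_S x)%:E)%E.

Let mS : measurable S.
Proof.
have -> : S = setT `&` (fun x : R => `|x|) @^-1` `[rho, +oo[.
  by rewrite setTI; apply/seteqP; split => x; rewrite /S /= in_itv /= andbT.
by apply: measurableT_comp.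
Qed.

Let g (x : R) : R := inv_series a x * \1_S x.

Let gE x : S x -> g x = inv_series a x.
Proof. by move=> Sx; rewrite /g indicE mem_set // mulr1. Qed.

Let g_notin x : ~ S x -> g x = 0.
Proof. by move=> Sx; rewrite /g indicE memNset // mulr0. Qed.

Let g_ge0 x : 0 <= g x.
Proof.
by have [Sx|Sx] := pselect (S x); [rewrite gE // p_ge0|rewrite g_notin].
Qed.

(** Inside the disk [inv_series] may be a junk value, so measurability is obtained for the
    restriction to [S], as a pointwise limit of partial sums continuous there. *)
Let mg : measurable_fun (setT : set (measurableTypeR R)) g.
Proof.
have -> : g = (inv_series a) \_ S by rewrite patch_indic.
apply/(measurable_restrictT _ _).1 => //.
apply: (@measurable_fun_cvg _ _ _ _
  (fun N (x : measurableTypeR R) => complex.Re (PN N (toC x)))).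
- move=> N; have [] // := @cmeasurable_continuous S (fun x => PN N (toC x)) mS.
  move=> x Sx; apply: (c1_on_line_cvg (c1_laurent_sum a N)).
  by apply: upper_half_toC; rewrite -normr_gt0 (lt_le_trans rho_gt0).
- move=> x Sx; under eq_fun do rewrite laurent_sum_toC /=.
  exact: (inv_series_real_cvg rho_gt0 summable Sx).
Qed.

Let g_le x : `|g x| <= B / rho ^+ 2.
Proof.
have [Sx|Sx] := pselect (S x); last first.
  by rewrite g_notin // normr0 divr_ge0 ?laurent_bound_ge0 // exprn_ge0 // ltW.
rewrite gE // -cabs_toC -(inv_series_toC rho_gt0 summable) //.
apply: (le_trans (cabs_inv_series rho_gt0 summable _)); rewrite cabs_toC //.
exact: laurent_bound_mono.
Qed.

(** A bounded density on a bounded interval. This local finiteness makes [fine] reversible on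
    windows before the total mass is known to be finite. *)
Lemma lam_segment_lty (M : R) : (lam `[(- M)%R, M]%classic < +oo)%E.
Proof.
rewrite lam_density //; apply: integrable_lty => //.
apply: (Rintegrable_bounded (K := B / rho ^+ 2)) => //.
- exact: lebesgue_itv_lty.
- exact: measurable_funTS.
- by move=> x _; exact: g_le.
Qed.

Let segment_decomposition (M : R) : rho < M ->
  (`[- M, M]%classic `&` S) = `[rho, M]%classic `|` `[- M, - rho]%classic.
Proof.
move=> rM; apply/seteqP; split => x; rewrite /S /= !in_itv /= ler_normr.
- by case=> /andP[x1 x2] /orP[x3|x3]; [left|right]; apply/andP; split => //;
    rewrite lerNr.
- have r0 := rho_gt0; case=> /andP[x1 x2]; split.
  + by apply/andP; split; lra.
  + by rewrite x1.
  + by apply/andP; split; lra.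
  + by rewrite orbC lerNr x2.
Qed.

(** Here [pr] is the real or the imaginary part. The series is real on the axis, so by [prM] the
    density can be moved inside [pr]; it vanishes off [S], which cuts the window into two
    segments. *)
Let component (pr : Cx R -> R) (M : R) :
  (forall z (x : R), pr (z * toC x) = pr z * x) ->
  (forall D : set (measurableTypeR R), forall f : R -> Cx R,
     cmeasurable D f -> measurable_fun D (fun x => pr (f x))) ->
  (forall z, `|pr z| <= cabs z) ->
  rho < M ->
  \int[lam]_(x in `[- M, M]) pr (h (toC x)) =
  \int[leb]_(x in `[rho, M]) pr (hP (toC x)) +
  \int[leb]_(x in `[- M, - rho]) pr (hP (toC x)).
Proof.
move=> prM prm prle rM.
have mh : cmeasurable (`[- M, M]%classic : set (measurableTypeR R))
    (fun x => h (toC x)).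
  apply: cmeasurable_continuous => // x _.
  by apply: (c1_on_line_cvg ch); rewrite /closed_upper /=.
rewrite (Rintegral_density mg g_ge0 lam_density) //; last exact: (prm _ _ mh).
have -> : \int[leb]_(x in `[- M, M]) (pr (h (toC x)) * g x) =
    \int[leb]_(x in `[- M, M]) ((fun x => pr (hP (toC x))) \_ S) x.
  apply: eq_Rintegral => x _; rewrite /patch; case: ifPn => [/set_mem Sx|Sx].
    by rewrite gE // /hP (inv_series_toC rho_gt0 summable) // prM.
  by rewrite g_notin ?mulr0 // => Sx'; rewrite mem_set in Sx.
rewrite -Rintegral_mkcondr segment_decomposition // Rintegral_setU //.
- rewrite -segment_decomposition //.
  have mI : measurable (`[- M, M]%classic `&` S) by exact: measurableI.
  apply: (Rintegrable_bounded (K := K * (B / rho ^+ 2))) => //.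
  + apply: le_lt_trans (lebesgue_itv_lty (- M) M).
    by apply: le_measure; rewrite ?inE //; exact: subIsetl.
  + by apply: prm; apply: hP_line_cmeasurable => // x [].
  + move=> x [_ Sx]; apply: (le_trans (prle _)).
    by apply: hP_le; rewrite ?cabs_toC // /closed_upper /=.
- apply/disj_setPS => x [] /=; rewrite !in_itv /= => /andP[x1 _] /andP[_ x2].
  by have := le_trans x1 x2; rewrite leNgt => /negP; apply; have r0 := rho_gt0; lra.
Qed.

Lemma truncated_integral (M : R) : rho < M ->
  Cintegral lam `[- M, M] (fun x => h (toC x)) =
  arc_integral rho hP - arc_integral M hP.
Proof.
move=> rM; rewrite -segments_eq_arcs //; apply: CxP; rewrite !ReImE.
- apply: (@component (@complex.Re R)) => //.
  + by move=> z x; rewrite ReM /= mulr0 subr0.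
  + by move=> D f [].
  + exact: normRe_le.
- apply: (@component (@complex.Im R)) => //.
  + by move=> z x; rewrite ImM /= mulr0 add0r.
  + by move=> D f [].
  + exact: normIm_le.
Qed.

(** At this point [lam] is not known to be finite, so the integral over the line appears as a limit
    over windows. The radii use [n.+1] to exceed [rho] strictly. *)
Lemma truncated_integral_cvg :
  (fun n => Cintegral lam `[- (rho + n.+1%:R), rho + n.+1%:R]
     (fun x => h (toC x))) @ \oo --> arc_integral rho hP.
Proof.
have c : (fun n => arc_integral rho hP - arc_integral (rho + n.+1%:R) hP) @ \oo
    --> arc_integral rho hP - 0.
  exact: cvgB (@cvg_cst _ (arc_integral rho hP) _ \oo _) arc_integral_inv_series_cvg0.
rewrite subr0 in c.
rewrite (_ : (fun n => _) =
  (fun n => arc_integral rho hP - arc_integral (rho + n.+1%:R) hP)) //.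
by apply/funext => n; rewrite truncated_integral // ltrDl.
Qed.

End LineIntegral.

(** * Finiteness of the measure and integrals over the whole line *)

Section StieltjesFourier.
Variable R : realType.
Local Notation leb := (@lebesgue_measure R).
Variables (a : nat -> R) (rho : R).
Hypothesis rho_gt0 : 0 < rho.
Hypothesis summable : cvgn (fun N => \sum_(2 <= n < N) `|a n / rho ^+ n|).
Variable lam : {measure set (measurableTypeR R) -> \bar R}.
Hypothesis p_ge0 : forall x : R, rho <= `|x| -> 0 <= inv_series a x.
Hypothesis lam_density : forall A : set (measurableTypeR R), measurable A ->
  lam A = (\int[leb]_(x in A)
    (inv_series a x * \1_[set y : R | (rho <= `|y|)%R] x)%:E)%E.

Local Notation P := (inv_series (fun k => toC (a k))).

Let radius n : R := rho + n.+1%:R.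
Let window n : set (measurableTypeR R) := `[- radius n, radius n]%classic.

Let window_mono m n : (m <= n)%N -> window m `<=` window n.
Proof.
move=> mn x; rewrite /window /= !in_itv /= => /andP[x1 x2].
have rmn : radius m <= radius n by rewrite lerD2l ler_nat.
by rewrite (le_trans _ x1) ?lerN2 // (le_trans x2).
Qed.

Let near_window x : \forall n \near \oo, window n x.
Proof.
near=> n; rewrite /window /= in_itv /= -ler_norml.
have : `|x| < n%:R by near: n; exact: nbhs_infty_gtr.
rewrite /radius -natr1; have := rho_gt0; lra.
Unshelve. all: by end_near. Qed.

Let bigcup_window : \bigcup_n window n = setT.
Proof.
apply/seteqP; split=> // x _; have [N _ xN] := near_window x.
by exists N => //; apply: xN => /=.
Qed.

(* The total mass is the limit of lam over growing windows, and by
   truncated_integral_cvg for the constant 1 it is an arc integral. *)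
Lemma lam_lty : (lam setT < +oo)%E.
Proof.
have c1 := c1_cst (@closed_upper R) (1 : Cx R).
have b1 (w : Cx R) : closed_upper w -> cabs (1 : Cx R) <= 1 by rewrite cabs1.
have := truncated_integral_cvg rho_gt0 summable c1 b1 p_ge0 lam_density.
move/cvg_Re; set l := complex.Re _ => cl.
have cw : (fun n => lam (window n)) @ \oo --> l%:E.
  have -> : (fun n => lam (window n)) = EFin \o (fun n => fine (lam (window n))).
    apply/funext => n /=; rewrite fineK // ge0_fin_numE //.
    exact: (lam_segment_lty rho_gt0 summable lam_density).
  apply: cvg_EFin; first exact: nearW.
  move: cl; rewrite (_ : (fun n => _) = (fun n => fine (lam (window n)))) //.
  by apply/funext => n; rewrite /= Rintegral_cst ?mul1r.
have cT : (fun n => lam (window n)) @ \oo --> lam setT.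
  rewrite -bigcup_window; apply: nondecreasing_cvg_mu.
  - by move=> n; exact: measurable_itv.
  - by rewrite bigcup_window.
  - by move=> m n mn; apply/subsetPset; exact: window_mono.
by rewrite -(cvg_unique _ cw cT) // ltry.
Qed.

(** With finite total mass the constant [K] is integrable, so bounded convergence replaces the
    growing windows by the whole line. *)
Lemma line_integral_eq_arc (h : Cx R -> Cx R) (K : R) :
  c1_on (@closed_upper R) h ->
  (forall w, closed_upper w -> cabs (h w) <= K) ->
  Cintegral lam setT (fun x => h (toC x)) =
  arc_integral rho (fun w => h w * P w).
Proof.
move=> ch hK.
have mh : cmeasurable (setT : set (measurableTypeR R)) (fun x => h (toC x)).
  apply: cmeasurable_continuous => // x _.
  by apply: (c1_on_line_cvg ch); rewrite /closed_upper /=.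
pose F n (x : measurableTypeR R) := toC (\1_(window n) x) * h (toC x).
have FE n : Cintegral lam (window n) (fun x => h (toC x)) =
    Cintegral lam setT (F n).
  apply: CxP => /=; rewrite Rintegral_mkcond; apply: eq_Rintegral => x _.
  - rewrite patch_indic /= ReM /= mul0r subr0; exact: mulrC.
  - rewrite patch_indic /= ImM /= mul0r addr0; exact: mulrC.
have cF : (fun n => Cintegral lam setT (F n)) @ \oo -->
    Cintegral lam setT (fun x => h (toC x)).
  apply: (bounded_Cintegral_cvg (K := K)) => //.
  - exact: lam_lty.
  - move=> n; apply: cmeasurableM => //; split => /=; last exact: measurable_cst.
    by apply: measurable_indic; exact: measurable_itv.
  - move=> n x _; rewrite cabsM cabs_toC indicE.
    have hx : cabs (h (toC x)) <= K by apply: hK; rewrite /closed_upper /=.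
    case: (_ \in _); rewrite ?normr1 ?mul1r // normr0 mul0r.
    by rewrite (le_trans _ hx) ?cabs_ge0.
  (* Every point eventually lies in the windows, after which its sequence of values is constant. *)
  - move=> x _; apply: (cvg_near_cst).
    by apply: filterS (near_window x) => n xn; rewrite /F indicE mem_set // mul1r.
have := truncated_integral_cvg rho_gt0 summable ch hK p_ge0 lam_density.
under eq_fun do rewrite -/(radius _) -/(window _) FE.
by move=> cA; exact: (cvg_unique _ cF cA).
Qed.

End StieltjesFourier.

(** * Asymptotic expansions *)

Section Asymptotics.
Variable R : realType.

(** Uniqueness of asymptotic expansions. Once the coefficients below [n] vanish, the estimate of
    order [n.+1] can be divided by [u ^+ n], leaving [cabs (d n) <= K * u] for all small [u]. *)
Lemma asymptotic_zero (d : nat -> Cx R) (delta : R) : 0 < delta ->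
  (forall N, exists K, forall u, 0 < u < delta ->
     cabs (\sum_(n < N) d n * toC u ^+ n) <= K * u ^+ N) ->
  forall n, d n = 0.
Proof.
move=> delta0 dK; elim/ltn_ind => n IH; apply: cabs_eq0; apply/eqP.
rewrite eq_le cabs_ge0 andbT leNgt; apply/negP => c0.
have [K {}dK] := dK n.+1.
have cK u : 0 < u < delta -> cabs (d n) <= K * u.
  move=> uI; have := dK u uI; have [u0 _] := andP uI.
  rewrite big_ord_recr /= big1 ?add0r => [|i _]; last by rewrite IH ?mul0r.
  by rewrite cabsM cabsX cabs_toC gtr0_norm // exprS mulrA ler_pM2r ?exprn_gt0.
have K0 : 0 < K.
  have h0 : 0 < delta / 2 < delta by apply/andP; split; lra.
  by have := lt_le_trans c0 (cK _ h0); rewrite pmulr_lgt0 // divr_gt0.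
(* Small enough for [K * u] to be at most half of [cabs (d n)], which contradicts [cK]. *)
pose u := Num.min (delta / 2) (cabs (d n) / (2 * K)).
have u0 : 0 < u by rewrite lt_min !divr_gt0 // mulr_gt0.
have ud : u < delta by rewrite gt_min; apply/orP; left; lra.
have uI : 0 < u < delta by rewrite u0.
have uK : K * u <= cabs (d n) / 2.
  have : u <= cabs (d n) / (2 * K) by rewrite ge_min lexx orbT.
  move=> ule; apply: (le_trans (ler_wpM2l (ltW K0) ule)).
  by rewrite le_eqVlt; apply/orP; left; apply/eqP; field; rewrite gt_eqF.
have := le_trans (cK u uI) uK; lra.
Qed.

Lemma geometric_tail_le (q : R) (N m : nat) : 0 <= q <= 1 / 2 -> (N <= m)%N ->
  \sum_(N <= n < m) q ^+ n <= 2 * q ^+ N.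
Proof.
move=> /andP[q0 q1] Nm.
(* The subtracted term makes the induction close: for [q <= 1 / 2] the difference
   [2 * q ^+ m - 2 * q ^+ m.+1] pays for the new summand [q ^+ m]. *)
suff : \sum_(N <= n < m) q ^+ n <= 2 * q ^+ N - 2 * q ^+ m.
  by move/le_trans; apply; rewrite gerBl mulr_ge0 // exprn_ge0.
elim: m Nm => [|m IH]; first by rewrite leqn0 => /eqP ->; rewrite big_geq // subrr.
rewrite leq_eqVlt => /predU1P[->|Nm]; first by rewrite big_geq // subrr.
rewrite big_nat_recr //=; apply: (le_trans (lerD (IH Nm) (lexx _))).
have : q * q ^+ m <= 1 / 2 * q ^+ m by rewrite ler_wpM2r // exprn_ge0.
rewrite exprS; lra.
Qed.

(** Convergence at the single point [delta / 2] bounds the terms there. For [u] below [delta / 4]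
    the ratio to that point is at most 1 / 2, so the tail from [N] on is controlled by a geometric
    one. *)
Lemma power_series_asymptotic (e : nat -> Cx R) (S : R -> Cx R) (delta : R) :
  0 < delta ->
  (forall u, 0 < u < delta -> series (fun n => e n * toC u ^+ n) @ \oo --> S u) ->
  forall N, exists K, forall u, 0 < u < delta / 4 ->
    cabs (S u - \sum_(n < N) e n * toC u ^+ n) <= K * u ^+ N.
Proof.
move=> delta0 eS N; pose u0 := delta / 2.
have u00 : 0 < u0 by rewrite divr_gt0.
have u0I : 0 < u0 < delta by rewrite u00 /= /u0; lra.
have /cvg_seq_bounded[C [_ eC]] : cvgn (fun n => cabs (e n * toC u0 ^+ n)).
  apply/cvg_ex; exists (cabs 0); apply: cvg_cabs.
  by apply: cvg_series_cvg_0; apply/cvg_ex; exists (S u0); exact: eS.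
have {}eC n : cabs (e n) <= (C + 1) / u0 ^+ n.
  have C1 : C < C + 1 by rewrite ltrDl.
  have /= := eC _ C1 n I; rewrite (ger0_norm (cabs_ge0 _)).
  by rewrite cabsM cabsX cabs_toC gtr0_norm // ler_pdivlMr // exprn_gt0.
exists ((C + 1) * 2 / u0 ^+ N) => u /andP[up ud].
have uI : 0 < u < delta by rewrite up /=; lra.
have q1 : 0 <= u / u0 <= 1 / 2.
  apply/andP; split; first by rewrite divr_ge0 // ltW.
  by rewrite ler_pdivrMr // /u0; lra.
have C0 : 0 <= C + 1.
  by have := le_trans (cabs_ge0 _) (eC 0); rewrite expr0 divr1.
have cS : (fun m => cabs (series (fun n => e n * toC u ^+ n) m -
    \sum_(n < N) e n * toC u ^+ n)) @ \oo -->
    cabs (S u - \sum_(n < N) e n * toC u ^+ n).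
  apply: cvg_cabs.
  exact: cvgB (eS u uI) (@cvg_cst _ (\sum_(n < N) e n * toC u ^+ n) _ \oo _).
apply: (cvgr_to_le cS); near=> m.
have Nm : (N <= m)%N by near: m; exact: nbhs_infty_ge.
rewrite /series /= (big_cat_nat _ Nm) //= big_mkord addrAC subrr add0r.
apply: (le_trans (cabs_sum _ _ _)).
apply: (@le_trans _ _ (\sum_(N <= n < m) (C + 1) * (u / u0) ^+ n)).
  apply: ler_sum => n _; rewrite cabsM cabsX cabs_toC gtr0_norm //.
  by rewrite expr_div_n [leRHS]mulrCA [leLHS]mulrC ler_wpM2l ?exprn_ge0 ?(ltW up).
rewrite -mulr_sumr; apply: (le_trans (ler_wpM2l C0 (geometric_tail_le q1 Nm))).
by rewrite expr_div_n le_eqVlt; apply/orP; left; apply/eqP; ring.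
Unshelve. all: by end_near. Qed.

End Asymptotics.

(** * Taylor remainders of the exponential in the left half-plane *)

Section ExponentialTaylor.
Variable R : realType.

Lemma cabs_cexp (z : Cx R) : cabs (cexp z) = expR (complex.Re z).
Proof.
rewrite cabsE /cexp /= !exprMn -mulrDr cos2Dsin2 mulr1 sqrtr_sqr.
by rewrite ger0_norm // expR_ge0.
Qed.

Lemma cderivX (phi : R -> Cx R) (x : R) (l : Cx R) n : cderiv phi x l ->
  cderiv (fun t => phi t ^+ n.+1) x (n.+1%:R * phi x ^+ n * l).
Proof.
move=> p; elim: n => [|n IH].
  by under eq_fun do rewrite expr1; rewrite expr0 !mul1r.
have := cderivM p IH.
under eq_fun do rewrite -exprS.
by congr cderiv; rewrite -[n.+2%:R]natr1 exprS; ring.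
Qed.

(** The point [z] is fixed and [t] moves along its ray, so the remainder can be handled by calculus
    in one real variable; differentiation in [t] lowers [N] by one. *)
Definition exp_taylor (z : Cx R) (N : nat) (t : R) : Cx R :=
  \sum_(n < N) (toC t * z) ^+ n / n`!%:R.

Lemma cderiv_exp_taylor z N t :
  cderiv (exp_taylor z N.+1) t (z * exp_taylor z N t).
Proof.
have dz : cderiv (fun t => toC t * z) t z.
  by have := cderivM (cderiv_toC t) (cderiv_cst z t); rewrite mul1r mulr0 addr0.
elim: N => [|N IH].
  rewrite /exp_taylor big_ord0 mulr0.
  under eq_fun do rewrite big_ord1 expr0.
  exact: cderiv_cst.
have := cderivD IH (cderivM (cderivX N dz) (cderiv_cst (N.+1`!%:R^-1) t)).
have -> : (fun t0 => exp_taylor z N.+1 t0 + (toC t0 * z) ^+ N.+1 / N.+1`!%:R) =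
    exp_taylor z N.+2 by apply/funext => s; rewrite [RHS]big_ord_recr.
congr cderiv; rewrite mulr0 addr0 /exp_taylor [in RHS]big_ord_recr /= mulrDr.
congr (_ + _); rewrite factS natrM; field.
by rewrite nat1r !pnatr_eq0 -lt0n fact_gt0.
Qed.

(* Each step integrates the previous bound; the factor 2 per step pays for
   applying the mean value theorem to the two components separately. *)
Lemma exp_taylor_bound (z : Cx R) (L : R) N (t : R) :
  complex.Re z <= 0 -> cabs z <= L -> 0 <= t ->
  cabs (cexp (toC t * z) - exp_taylor z N t) <= (2 * L * t) ^+ N.
Proof.
move=> z0 zL; have L0 : 0 <= L := le_trans (cabs_ge0 z) zL.
elim: N t => [|N IH] t t0.
  (* The sign of the real part of [z] enters here: the exponential has modulus at most 1 along the
     whole ray. *)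
  rewrite /exp_taylor big_ord0 subr0 cabs_cexp expr0 -expR0 ler_expR.
  by rewrite ReM /= mul0r subr0 mulr_ge0_le0.
pose phi s := cexp (toC s * z) - exp_taylor z N.+1 s.
have dphi s : cderiv phi s (z * (cexp (toC s * z) - exp_taylor z N s)).
  have dz : cderiv (fun t => toC t * z) s z.
    by have := cderivM (cderiv_toC s) (cderiv_cst z s); rewrite mul1r mulr0 addr0.
  have := cderivD (cderiv_cexp dz) (cderivM (cderiv_cst (-1) s) (cderiv_exp_taylor z N s)).
  have -> : (fun t0 => cexp (toC t0 * z) + -1 * exp_taylor z N.+1 t0) = phi.
    by apply/funext => x; rewrite mulN1r.
  by congr cderiv; ring.
have phi0 : phi 0 = 0.
  rewrite /phi /exp_taylor big_ord_recl /= big1 ?addr0.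
    have -> : cexp (toC 0 * z) = 1.
      by rewrite toC0 mul0r /cexp /= expR0 cos0 sin0 mulr1 mulr0.
    by rewrite expr0 fact0 invr1 mulr1 subrr.
  by move=> i _; rewrite toC0 mul0r /bump /= expr0n mul0r.
have [->|tn0] := eqVneq t 0.
  by rewrite -/(phi 0) phi0 cabs0 exprn_ge0 // mulr0.
have tp : 0 < t by rewrite lt_neqAle eq_sym tn0.
have comp (pr : Cx R -> R) : (forall w, `|pr w| <= cabs w) -> pr 0 = 0 ->
    (forall s l, cderiv phi s l -> is_derive s 1 (fun x => pr (phi x)) (pr l)) ->
    `|pr (phi t)| <= t * (L * (2 * L * t) ^+ N).
  move=> prle pr0 prd.
  have [|c cI] := @MVT R (fun x => pr (phi x))
    (fun s => pr (z * (cexp (toC s * z) - exp_taylor z N s))) 0 t tp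
    (fun s _ => prd _ _ (dphi s)).
    apply: continuous_in_subspaceT => s _; exact: is_derive_cvg (prd _ _ (dphi s)).
  rewrite phi0 pr0 !subr0 => ->.
  rewrite normrM (ger0_norm t0) mulrC ler_wpM2l //.
  apply: (le_trans (prle _)); rewrite cabsM ler_pM ?cabs_ge0 //.
  move: cI; rewrite in_itv /= => /andP[c0 ct].
  apply: (le_trans (IH c (ltW c0))); rewrite lerXn2r ?nnegrE ?mulr_ge0 ?(ltW c0) //.
  by rewrite ler_wpM2l ?mulr_ge0 // ltW.
apply: (le_trans (cabs_le _)).
have hr := comp (@complex.Re R) (@normRe_le R) erefl (fun s l h => h.1).
have hi := comp (@complex.Im R) (@normIm_le R) erefl (fun s l h => h.2).
apply: (le_trans (lerD hr hi)); rewrite exprS le_eqVlt; apply/orP; left.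
by apply/eqP; ring.
Qed.

End ExponentialTaylor.

(** * Identification of the coefficients *)

Section Coefficients.
Variable R : realType.
Local Notation leb := (@lebesgue_measure R).
Local Notation arc := Defs.arc.
Variables (a : nat -> R) (rho : R).
Hypothesis rho_gt0 : 0 < rho.
Hypothesis summable : cvgn (fun N => \sum_(2 <= n < N) `|a n / rho ^+ n|).

Local Notation P := (inv_series (fun k => toC (a k))).
Local Notation B := (laurent_bound a rho).

Let density_arc_le (h : Cx R -> Cx R) (K t : R) :
  (forall w, closed_upper w -> cabs w = rho -> cabs (h w) <= K) ->
  0 <= t <= pi ->
  cabs (h (arc rho t) * P (arc rho t) * (iC * arc rho t)) <= K * (B / rho).
Proof.
move=> hK tI; have uw := upper_half_arc rho_gt0 tI.
have aw : cabs (arc rho t) = rho by rewrite cabs_arc // ltW.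
rewrite -mulrA cabsM ler_pM ?cabs_ge0 //; first by apply: hK => //; case: uw.
(* The earlier estimate asks for a bound on all of [closed_upper], which powers of [w] do not have.
   It is applied to the constant 1, and [h] is bounded separately on the circle. *)
have b1 (w : Cx R) : closed_upper w -> cabs (1 : Cx R) <= 1 by rewrite cabs1.
have := cabs_inv_series_arc_le rho_gt0 summable (h := fun=> 1) b1 (lexx rho) tI.
by rewrite !mul1r.
Qed.

Let arc_cintegrable (h : Cx R -> Cx R) (K : R) : c1_on (@closed_upper R) h ->
  (forall w, closed_upper w -> cabs w = rho -> cabs (h w) <= K) ->
  cintegrable leb `[0, pi] (fun t => h (arc rho t) * P (arc rho t) * (iC * arc rho t)).
Proof.
move=> ch hK; apply: (cintegrable_bounded (K := K * (B / rho))) => //.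
- exact: lebesgue_itv_lty.
- exact: (inv_series_arc_cmeasurable rho_gt0 summable ch (lexx rho)).
- by move=> t; rewrite /= in_itv /= => tI; exact: density_arc_le.
Qed.

(** These replace the moments of [lam], which need not exist for [n >= 1]. *)
Definition moment n : Cx R := arc_integral rho (fun w => w ^+ n * P w).

Lemma arc_integralZl (k : Cx R) (h : Cx R -> Cx R) (K : R) :
  c1_on (@closed_upper R) h ->
  (forall w, closed_upper w -> cabs w = rho -> cabs (h w) <= K) ->
  arc_integral rho (fun w => k * h w * P w) =
  k * arc_integral rho (fun w => h w * P w).
Proof.
move=> ch hK; rewrite /arc_integral -CintegralZl //; last exact: arc_cintegrable ch hK.
by apply: eq_Cintegral => t _; rewrite !mulrA.
Qed.

Let pow_bound n (w : Cx R) : closed_upper w -> cabs w = rho ->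
  cabs (w ^+ n) <= rho ^+ n.
Proof. by move=> _ wr; rewrite cabsX wr. Qed.

Let c1_pow n : c1_on (@closed_upper R) (fun w : Cx R => w ^+ n).
Proof. exact/c1X/c1_id. Qed.

(** By linearity the difference is the arc integral of the remainder of [h]. In the application [k]
    carries the powers of [iC * toC u], and [K] is of order [u ^+ N]. *)
Lemma arc_integral_remainder (h : Cx R -> Cx R) (k : nat -> Cx R) (N : nat)
    (K : R) : c1_on (@closed_upper R) h ->
  (forall w, closed_upper w -> cabs w = rho ->
     cabs (h w - \sum_(n < N) k n * w ^+ n) <= K) ->
  cabs (arc_integral rho (fun w => h w * P w) - \sum_(n < N) k n * moment n) <=
  K * (B / rho) * fine (leb `[0, pi]%classic) *+ 2.
Proof.
move=> ch hK; pose q w := h w - \sum_(n < N) k n * w ^+ n.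
have cq : c1_on (@closed_upper R) q.
  rewrite (_ : q = fun w => h w + -1 * \sum_(n < N) k n * w ^+ n); last first.
    by apply/funext => w; rewrite mulN1r.
  have cs : c1_on (@closed_upper R) (fun w => \sum_(n < N) k n * w ^+ n).
    apply: (c1_sum _ (F := fun (n : 'I_N) w => k n * w ^+ n)) => n.
    exact: c1M (c1_cst _ (k n)) (c1_pow n).
  exact: c1D ch (c1M (c1_cst _ (-1)) cs).
pose f n t := k n * (arc rho t ^+ n * P (arc rho t) * (iC * arc rho t)).
have fi (n : 'I_N) : cintegrable leb `[0, pi] (f n).
  by apply: cintegrableZl => //; exact: arc_cintegrable (c1_pow n) (pow_bound n).
have m0pi : measurable (`[0, pi]%classic : set (measurableTypeR R)).
  exact: measurable_itv.
have [fs fsi] := Cintegral_sum (index_enum 'I_N) m0pi fi.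
have qi := arc_cintegrable cq hK.
have -> : arc_integral rho (fun w => h w * P w) =
    arc_integral rho (fun w => q w * P w) + \sum_(n < N) k n * moment n.
  have -> : \sum_(n < N) k n * moment n = \sum_(n < N) Cintegral leb `[0, pi] (f n).
    apply: eq_bigr => n _; rewrite /f CintegralZl //.
    exact: arc_cintegrable (c1_pow n) (pow_bound n).
  rewrite -fs /arc_integral -CintegralD //; apply: eq_Cintegral => t _.
  rewrite (_ : \sum_(n < N) f n t =
    (\sum_(n < N) k n * arc rho t ^+ n) * P (arc rho t) * (iC * arc rho t)).
    by rewrite -!mulrDl /q subrK.
  by rewrite !mulr_suml; apply: eq_bigr => n _; rewrite /f !mulrA.
rewrite addrK; apply: cabs_Cintegral_le => //; first exact: lebesgue_itv_lty.
  exact: (inv_series_arc_cmeasurable rho_gt0 summable cq (lexx rho)).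
by move=> t; rewrite /= in_itv /= => tI; exact: density_arc_le.
Qed.

(* With q = i u w, both transforms have the form \int H(q) p(w) dw over the arc,
   and H(q) = \sum_n kappa_n q^n identifies the expansion in u. *)
Lemma coefficients_eq_moments (H : Cx R -> Cx R) (kappa e : nat -> Cx R)
    (S : R -> Cx R) (delta : R) : 0 < delta ->
  (forall u, 0 < u < delta ->
     c1_on (@closed_upper R) (fun w => H (iC * toC u * w))) ->
  (forall N, exists K, forall u (w : Cx R), 0 < u < delta -> closed_upper w ->
     cabs w = rho ->
     cabs (H (iC * toC u * w) - \sum_(n < N) kappa n * (iC * toC u * w) ^+ n)
       <= K * u ^+ N) ->
  (forall u, 0 < u < delta ->
     S u = arc_integral rho (fun w => H (iC * toC u * w) * P w)) ->
  (forall u, 0 < u < delta ->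
     series (fun n => e n * (iC * toC u) ^+ n) @ \oo --> S u) ->
  forall n, e n = kappa n * moment n.
Proof.
move=> delta0 cH HK SE eS n.
have i0 : (iC : Cx R) ^+ n != 0.
  by rewrite expf_neq0 // -cabs_gt0 cabs_iC.
apply: (mulIf i0); apply/eqP; rewrite -subr_eq0; apply/eqP.
(* The comparison is in the real variable [u], so the powers of [iC] are kept in the coefficients.
   The range [delta / 4] is the one of [power_series_asymptotic]. *)
apply: (@asymptotic_zero R (fun n => e n * iC ^+ n - kappa n * moment n * iC ^+ n)
  (delta / 4)); first by rewrite divr_gt0.
move=> N.
have eS' u : 0 < u < delta ->
    series (fun n => e n * iC ^+ n * toC u ^+ n) @ \oo --> S u.
  move=> uI; have -> : (fun n => e n * iC ^+ n * toC u ^+ n) =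
      (fun n => e n * (iC * toC u) ^+ n).
    by apply/funext => m; rewrite exprMn mulrA.
  exact: eS.
have [K1 h1] := power_series_asymptotic delta0 eS' N.
have [K2 h2] := HK N.
exists (K1 + K2 * (B / rho) * fine (leb `[0, pi]%classic) *+ 2) => u uI.
have uI' : 0 < u < delta.
  by have /andP[u0 ud] := uI; rewrite u0 /=; lra.
have h3 : cabs (S u - \sum_(m < N) kappa m * (iC * toC u) ^+ m * moment m)
    <= K2 * u ^+ N * (B / rho) * fine (leb `[0, pi]%classic) *+ 2.
  rewrite SE //; apply: (@arc_integral_remainder (fun w => H (iC * toC u * w))
    (fun m => kappa m * (iC * toC u) ^+ m) N _ (cH u uI')) => w uw wr.
  have -> : \sum_(m < N) kappa m * (iC * toC u) ^+ m * w ^+ m =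
      \sum_(m < N) kappa m * (iC * toC u * w) ^+ m.
    by apply: eq_bigr => m _; rewrite -mulrA -exprMn.
  exact: h2 u w uI' uw wr.
have {}h1 := h1 u uI.
have -> : \sum_(m < N) (e m * iC ^+ m - kappa m * moment m * iC ^+ m) *
    toC u ^+ m = (\sum_(m < N) e m * iC ^+ m * toC u ^+ m) -
    \sum_(m < N) kappa m * (iC * toC u) ^+ m * moment m.
  by rewrite -sumrB; apply: eq_bigr => m _; rewrite exprMn; ring.
(* Inserting [S u] splits the difference of the two polynomials into the errors bounded by [h3] and
   [h1]. *)
rewrite -[X in cabs (X - _)](subKr (S u)) -addrA [- _ - _]addrC addrA.
apply: (le_trans (cabsD _ _)); rewrite cabsN.
apply: (le_trans (lerD h3 h1)); rewrite le_eqVlt; apply/orP; left; apply/eqP.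
ring.
Qed.

End Coefficients.

(** * The Fourier and Stieltjes kernels on the closed upper half-plane *)

Section Kernels.
Variable R : realType.
Implicit Types w : Cx R.

(** This sign bounds both kernels on [closed_upper]: for q = iuw the exponential has modulus at most
    1, and 1 - q has real part at least 1. *)
Lemma Re_rotation_le0 (u : R) w : 0 <= u -> closed_upper w ->
  complex.Re (iC * toC u * w) <= 0.
Proof.
move=> u0 w0.
have -> : complex.Re (iC * toC u * w) = - (u * complex.Im w).
  by rewrite !ReImE /=; ring.
by rewrite oppr_le0 mulr_ge0.
Qed.

Lemma rotation_neq0 (u : R) : 0 < u -> iC * toC u != 0 :> Cx R.
Proof.
by move=> u0; rewrite -cabs_gt0 cabsM cabs_iC cabs_toC mul1r normr_gt0 gt_eqF.
Qed.

Lemma c1_rotation D (u : R) : c1_on D (fun w => iC * toC u * w).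
Proof. by apply: c1M; [exact: c1_cst|exact: c1_id]. Qed.

Lemma cabs_fourier_kernel (u : R) w : 0 <= u -> closed_upper w ->
  cabs (cexp (iC * toC u * w)) <= 1.
Proof.
by move=> u0 w0; rewrite cabs_cexp -expR0 ler_expR Re_rotation_le0.
Qed.

(** In [exp_taylor_bound] the real parameter is [u] and the fixed point is [iC * w], of modulus
    [rho]; hence the power of [2 * rho]. *)
Lemma fourier_kernel_taylor (rho u : R) w N : 0 <= u -> closed_upper w ->
  cabs w = rho ->
  cabs (cexp (iC * toC u * w) -
    \sum_(n < N) (n`!%:R)^-1 * (iC * toC u * w) ^+ n) <= (2 * rho) ^+ N * u ^+ N.
Proof.
move=> u0 w0 wr; rewrite -exprMn.
have Re0 : complex.Re (iC * w) <= 0.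
  by have := Re_rotation_le0 ler01 w0; rewrite toC1 mulr1.
have wL : cabs (iC * w) <= rho by rewrite cabsM cabs_iC mul1r wr.
apply: le_trans (exp_taylor_bound N Re0 wL u0).
rewrite (_ : iC * toC u * w = toC u * (iC * w)); last by ring.
rewrite le_eqVlt; apply/orP; left; apply/eqP; congr (cabs (_ - _)).
by apply: eq_bigr => n _; rewrite mulrC.
Qed.

Lemma stieltjes_kernel_ge1 (u : R) w : 0 <= u -> closed_upper w ->
  1 <= cabs (1 - iC * toC u * w).
Proof.
move=> u0 w0; apply: le_trans (normRe_le _); apply: le_trans (ler_norm _).
by rewrite ReD ReN Re1 lerDl oppr_ge0 Re_rotation_le0.
Qed.

Lemma stieltjes_kernel_neq0 (u : R) w : 0 <= u -> closed_upper w ->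
  1 - iC * toC u * w != 0.
Proof.
by move=> u0 w0; rewrite -cabs_gt0 (lt_le_trans ltr01) ?stieltjes_kernel_ge1.
Qed.

Lemma c1_stieltjes_kernel (u : R) : 0 <= u ->
  c1_on (@closed_upper R) (fun w => (1 - iC * toC u * w)^-1).
Proof.
move=> u0; apply: c1V => [w w0|]; first exact: stieltjes_kernel_neq0.
rewrite (_ : (fun w => _) = fun w => 1 + -1 * (iC * toC u * w)); last first.
  by apply/funext => w; rewrite mulN1r.
apply: c1D; first exact: c1_cst.
by apply: c1M; [exact: c1_cst|exact: c1_rotation].
Qed.

Lemma cabs_stieltjes_kernel (u : R) w : 0 <= u -> closed_upper w ->
  cabs ((1 - iC * toC u * w)^-1) <= 1.
Proof.
move=> u0 w0; rewrite cabsV invf_le1 ?stieltjes_kernel_ge1 //.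
exact: lt_le_trans ltr01 (stieltjes_kernel_ge1 u0 w0).
Qed.

(** The remainder of the finite geometric sum is exactly q^N / (1 - q), so the estimate does not ask
    for |q| < 1. *)
Lemma stieltjes_kernel_taylor (rho u : R) w N : 0 <= u -> closed_upper w ->
  cabs w = rho ->
  cabs ((1 - iC * toC u * w)^-1 - \sum_(n < N) 1 * (iC * toC u * w) ^+ n) <=
  rho ^+ N * u ^+ N.
Proof.
move=> u0 w0 wr; have n0 := stieltjes_kernel_neq0 u0 w0.
set q := iC * toC u * w in n0 *.
have -> : (1 - q)^-1 - \sum_(n < N) 1 * q ^+ n = q ^+ N * (1 - q)^-1.
  elim: N => [|N IH]; first by rewrite big_ord0 subr0 mul1r.
  by rewrite big_ord_recr /= opprD addrA IH exprS; field.
rewrite cabsM cabsX -exprMn -[leRHS]mulr1 ler_pM ?exprn_ge0 ?cabs_ge0 //.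
  by rewrite /q !cabsM cabs_iC cabs_toC (ger0_norm u0) mul1r wr mulrC.
exact: cabs_stieltjes_kernel.
Qed.

Lemma stieltjes_kernelE (u : R) w : 0 < u ->
  (1 - iC * toC u * w)^-1 = (iC * toC u)^-1 * ((iC * toC u)^-1 - w)^-1.
Proof.
by move=> u0; rewrite -invfM mulrBr mulfV ?rotation_neq0.
Qed.

End Kernels.

Theorem theorem2p4 (R : realType) (r rho : R) (a : nat -> R)
    (lam : {measure set (measurableTypeR R) -> \bar R})
    (Gt Ft : Cx R -> Cx R) (b c : nat -> Cx R)
    (r_gt0 : 0 < r) (r_lt_rho : r < rho)
    (a_summable : forall x : R, r < `|x| ->
       cvgn (fun N => \sum_(2 <= n < N) `|a n / x ^+ n|))
    (p_ge0 : forall x : R, rho <= `|x| -> 0 <= inv_series a x)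
    (lam_density : forall A : set (measurableTypeR R), measurable A ->
       lam A = (\int[@lebesgue_measure R]_(x in A)
          (inv_series a x * \1_[set y : R | (rho <= `|y|)%R] x)%:E)%E)
    (Gt_holomorphic : holomorphic_on
       (lower_half_plane `|` disk_exterior rho) Gt)
    (Gt_extends : forall z, lower_half_plane z -> Gt z = stieltjes lam z)
    (Gt_expansion : forall z, disk_exterior rho z ->
       series (fun n => b n / z ^+ n.+1) @ \oo --> Gt z)
    (Ft_entire : holomorphic_on setT Ft)
    (Ft_extends : forall x : R, 0 < x -> Ft (toC x) = fourier lam x)
    (Ft_expansion : forall z : Cx R,
       series (fun n => c n / n`!%:R * (iC * z) ^+ n) @ \oo --> Ft z) :
  forall n : nat,
    b n = c n /\
    c n = arc_integral rho
            (fun z => z ^+ n * inv_series (fun k => toC (a k)) z).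
Proof.
have rho0 : 0 < rho by exact: lt_trans r_lt_rho.
(* Strictness of [r < rho] gives absolute convergence on the circle of radius [rho] itself. *)
have summable : cvgn (fun N => \sum_(2 <= n < N) `|a n / rho ^+ n|).
  by apply: a_summable; rewrite gtr0_norm.
have line := line_integral_eq_arc rho0 summable p_ge0 lam_density.
have cm n : c n = moment a rho n.
  have f0 : (n`!%:R : Cx R) != 0 by rewrite pnatr_eq0 -lt0n fact_gt0.
  apply: (mulIf (invr_neq0 f0)); rewrite [RHS]mulrC.
  (* The expansion of [Ft] holds for every [u], so the range [delta := 1], fixed by [ltr01], is
     arbitrary. *)
  apply: (coefficients_eq_moments rho0 summable (H := @cexp R)
    (kappa := fun n => n`!%:R^-1) (e := fun n => c n / n`!%:R)
    (S := fun u => Ft (toC u)) ltr01).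
  - by move=> u _; exact/c1_cexp/c1_rotation.
  - move=> N; exists ((2 * rho) ^+ N) => u w /andP[u0 _] w0 wr.
    exact: fourier_kernel_taylor (ltW u0) w0 wr.
  - move=> u /andP[u0 _]; rewrite Ft_extends //.
    rewrite -(line (fun w => cexp (iC * toC u * w)) 1).
    + by apply: eq_Cintegral => x _; rewrite mulrAC.
    + exact/c1_cexp/c1_rotation.
    + by move=> w; apply: cabs_fourier_kernel; exact: ltW.
  - by move=> u _; exact: Ft_expansion.
have bm n : b n = moment a rho n.
  rewrite -[RHS]mul1r.
  (* With z = 1 / (iu), the extra factor z turns b_n / z^(n+1) into b_n (iu)^n. The condition
     [u < rho^-1] says that z lies outside the disk. *)
  apply: (coefficients_eq_moments rho0 summable (H := fun q => (1 - q)^-1)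
    (kappa := fun=> 1) (e := b) (delta := rho^-1)
    (S := fun u => (iC * toC u)^-1 * Gt ((iC * toC u)^-1))).
  - by rewrite invr_gt0.
  - by move=> u /andP[u0 _]; apply: c1_stieltjes_kernel; exact: ltW.
  - move=> N; exists (rho ^+ N) => u w /andP[u0 _] w0 wr.
    exact: stieltjes_kernel_taylor (ltW u0) w0 wr.
  - move=> u /andP[u0 _]; set z := (iC * toC u)^-1.
    have z0 : z != 0 by rewrite invr_eq0 rotation_neq0.
    have kE w : (z - w)^-1 = z^-1 * (1 - iC * toC u * w)^-1.
      by rewrite stieltjes_kernelE // -/z mulrA mulVf ?mul1r.
    (* The only singularity of the kernel is z itself, below the real axis; rewriting through [kE]
       reduces regularity and boundedness on [closed_upper] to those of the normalised kernel. *)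
    have ck : c1_on (@closed_upper R) (fun w => (z - w)^-1).
      under eq_fun do rewrite kE; apply: c1M; first exact: c1_cst.
      by apply: c1_stieltjes_kernel; exact: ltW.
    have kK w : closed_upper w -> cabs ((z - w)^-1) <= cabs z^-1.
      move=> w0; rewrite kE cabsM ler_piMr ?cabs_ge0 //.
      by apply: cabs_stieltjes_kernel => //; exact: ltW.
    have zlow : lower_half_plane z.
      have iu : iC * toC u = Complex 0 u :> Cx R.
        by apply: CxP; rewrite !ReImE /=; ring.
      have : complex.Im z = - u / (0 ^+ 2 + u ^+ 2) by rewrite /z iu ImV.
      rewrite /lower_half_plane /= => ->.
      by rewrite mulNr oppr_lt0 expr0n add0r divr_gt0 // exprn_gt0.
    rewrite Gt_extends //.
    rewrite /stieltjes (line (fun w => (z - w)^-1) _ ck kK).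
    rewrite -(arc_integralZl rho0 summable z ck (K := cabs z^-1)); last first.
      by move=> w w0 _; exact: kK.
    by apply: eq_Cintegral => t _; rewrite stieltjes_kernelE.
  - move=> u /andP[u0 ur]; set z := (iC * toC u)^-1.
    have z0 : z != 0 by rewrite invr_eq0 rotation_neq0.
    have zr : disk_exterior rho z.
      rewrite /disk_exterior /= normCx ltcE /= eqxx /=.
      rewrite cabsV cabsM cabs_iC cabs_toC mul1r gtr0_norm //.
      by rewrite -(invrK rho) ltf_pV2 // posrE ?invr_gt0.
    have cz := cvgM (@cvg_cst _ z _ \oo _) (Gt_expansion z zr).
    rewrite (_ : series _ = (fun N => z * series (fun n => b n / z ^+ n.+1) N)).
      exact: cz.
    apply/funext => N; rewrite /series /= mulr_sumr; apply: eq_bigr => m _.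
    have -> : iC * toC u = z^-1 by rewrite /z invrK.
    by rewrite exprVn exprS; field; rewrite expf_neq0 ?z0.
by move=> n; rewrite cm bm.
Qed.
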